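(* Let $q$ be a nonzero complex number with $|q|<1$. Let $t,m\in\mathbb{Z}$ with $t\geq1$ and $1-t\leq m\leq t$. For generic $x$ (that is, $x\in\mathbb{C}\setminus\{0\}$ not an odd integral power of $q$), we have $$\begin{aligned}\mathcal{O}_t^{(m)}(x;q)=\;&\frac{q^{3-8t^2-2(m-1)(2t-1)}}{\Theta(xq;q^2)\,(q^2;q^2)_\infty^2}\sum_{k=0}^{4t^2-2}(-1)^{k+1}q^{k^2+3k}\,f_{1,2t,1}\bigl(q^{2t+2m+2-8t^2+2k},\,q^{2t+2m};q^2\bigr)\\&\times f_{1,4t^2-1,4t^2(4t^2-1)}\bigl(x^{-1}q^{2k+1},\,-q^{16t^4-4t^2-2(m-1)(2t-1)+8t^2k};q^2\bigr).\end{aligned}$$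
   Context: Notation: $(a;q)_n=\prod_{k=1}^{n}(1-aq^{k-1})$ for $n\in\mathbb{N}\cup\{\infty\}$; in particular $(q^2;q^2)_\infty=\prod_{k\ge1}(1-q^{2k})$. The theta function is $\Theta(x;q)=(x;q)_\infty(q/x;q)_\infty(q;q)_\infty=\sum_{n\in\mathbb{Z}}(-1)^nq^{\binom n2}x^n$; $\Theta(\cdot;q^2)$ means $q$ is replaced by $q^2$. Set $\mathrm{sg}(r)=1$ if $r\ge0$ and $\mathrm{sg}(r)=-1$ if $r<0$, and $\mathrm{sg}(r,s)=\frac{\mathrm{sg}(r)+\mathrm{sg}(s)}{2}$. For positive integers $a,b,c$ the Hecke-type double sum is $$f_{a,b,c}(x,y;q)=\sum_{r,s\in\mathbb{Z}}\mathrm{sg}(r,s)(-1)^{r+s}x^ry^sq^{a\binom r2+brs+c\binom s2},$$ and $f_{a,b,c}(x,y;q^2)$ means $q$ is replaced by $q^2$. Here $\binom{n}{2}=n(n-1)/2$ for every integer $n$. Define $$p_{t,m}(x;q)=\left(\sum_{r,s\ge0}-\sum_{r,s<0}\right)\frac{(-1)^{r+s}q^{\binom r2+2trs+\binom s2+(t+m)r+(t+m)s}}{1-xq^r},\qquad \mathcal{O}_t^{(m)}(x;q)=\frac{q}{(q^2;q^2)_\infty^2}\,p_{t,m}(qx;q^2),$$ where $p_{t,m}(qx;q^2)$ means that $x$ is replaced by $qx$ and $q$ by $q^2$ in $p_{t,m}(x;q)$. *)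

(* Defs.v *)
(* The complex numbers are R[i] for R : realType; the definitions are stated for
   any numClosedFieldType, whose topology is the canonical one of its norm. *)
From mathcomp Require Export all_boot all_order all_algebra complex.
From mathcomp Require Export boolp classical_sets reals topology normedtype.
From mathcomp Require Export sequences.
(* Not imported: its [summable] would clash with the one of esum. *)
From mathcomp Require summability.

Export Order.TTheory GRing.Theory Num.Theory.
Export numFieldNormedType.Exports.

Set Implicit Arguments.
Unset Strict Implicit.
Unset Printing Implicit Defensive.

#[export] Set Implicit Arguments.
#[export] Unset Strict Implicit.
#[export] Unset Printing Implicit Defensive.

Local Open Scope ring_scope.

Definition qpoch (C : numClosedFieldType) (a q : C) (n : nat) : C :=
  \prod_(1 <= k < n.+1) (1 - a * q ^+ k.-1).

Definition qpoch_inf (C : numClosedFieldType) (a q : C) : C :=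
  limn (qpoch a q).

Definition theta (C : numClosedFieldType) (x q : C) : C :=
  qpoch_inf x q * qpoch_inf (q / x) q * qpoch_inf q q.

(* The product of consecutive integers is even, so the Euclidean quotient is
   exact, for negative n as well. *)
Definition binom2 (n : int) : int := ((n * (n - 1)) %/ 2)%Z.

(* Unordered summation: the limit of the finite partial sums along the
   inclusion-directed finite subsets of Z^2. *)
Definition sumZ2 (C : numClosedFieldType) (F : int -> int -> C) : C :=
  summability.sum (fun rs : int * int => F rs.1 rs.2).

Definition sumZ2_on (C : numClosedFieldType) (P : int -> int -> bool)
    (F : int -> int -> C) : C :=
  sumZ2 (fun r s => if P r s then F r s else 0).

Definition sg (C : numClosedFieldType) (r : int) : C :=
  if 0 <= r then 1 else -1.

Definition sg2 (C : numClosedFieldType) (r s : int) : C :=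
  (sg C r + sg C s) / 2.

Definition hecke_f (C : numClosedFieldType) (a b c : int) (x y q : C) : C :=
  sumZ2 (fun r s =>
    sg2 C r s * (-1) ^ (r + s) * x ^ r * y ^ s
    * q ^ (a * binom2 r + b * r * s + c * binom2 s)).

Definition p_term (C : numClosedFieldType) (t m : int) (x q : C) (r s : int)
    : C :=
  (-1) ^ (r + s)
  * q ^ (binom2 r + 2 * t * r * s + binom2 s + (t + m) * r + (t + m) * s)
  / (1 - x * q ^ r).

Definition p_sum (C : numClosedFieldType) (t m : int) (x q : C) : C :=
  sumZ2_on (fun r s => (0 <= r) && (0 <= s)) (p_term t m x q)
  - sumZ2_on (fun r s => (r < 0) && (s < 0)) (p_term t m x q).

Definition calO (C : numClosedFieldType) (t m : int) (x q : C) : C :=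
  q / qpoch_inf (q ^+ 2) (q ^+ 2) ^+ 2 * p_sum t m (q * x) (q ^+ 2).

(* Main.v *)
(* Put Q = q^2, y = q x and D = 4 t^2 - 1.  The theta function divided by
   1 - y Q^r is a Hecke-type double sum over (M, n), so that theta(y; Q) times
   p_{t,m}(y; Q) is a quadruple sum over (r, s, M, n); the bounds on m make it
   absolutely convergent.  Summing over (r, s) first gives, for each n, a value of
   f_{1,2t,1} at integral powers of Q.  Theta functions vanish at integral
   powers of Q, so these values are quasi-periodic in n with period D, without
   correction terms; writing n = k + D S with 0 <= k < D, the remaining sum over
   (M, S) is the second Hecke sum. *)

Require Import Defs.
From mathcomp Require Import finmap zify ring lra exp.
From mathcomp Require Import summability.

Local Open Scope classical_set_scope.
Local Open Scope fset_scope.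
Local Open Scope ring_scope.

#[local] Existing Instance totally_filter.

(** * Unordered sums *)

(** The obstacle is convergence. Expanding 1/(1 - y Q^r) geometrically would restrict y by
    conditions depending on r; multiplying by theta removes the pole, but the quadratic form of the
    resulting quadruple sum is degenerate. Where (r, s) and (M, n) have opposite signs, r^2 + (M +
    n)^2 + 2 r n equals (|M| + |n| - |r|)^2 + 2 |r| |M|, so along some rays the exponent grows only
    linearly; 1 <= t + m <= 2 t makes that growth positive. The period D arises because 2 t shifts
    of one index of f_{1,2t,1} and one shift of the other change the second parameter equally, and
    the first by amounts differing by D. For n = k + D S, the square of n contributes D^2 to the
    coefficient of S^2 in the exponent of q and the quasi-period contributes D; D^2 + D = 4 t^2 D is
    the third parameter of the second Hecke sum. *)

Section HasSum.
Variable K : numFieldType.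

(** [summability.sum] is a limit operator, uninformative when no limit exists. The proof works with
    this relation and passes to values through [has_sumE]. *)
Definition has_sum (I : choiceType) (f : I -> K) (l : K) : Prop :=
  partial_sum f @ totally --> l.

Definition abs_summable (I : choiceType) (f : I -> K) : Prop :=
  exists M : K, forall A : {fset I}, \sum_(i <- A) `|f i| <= M.

Lemma partial_sumE (I : choiceType) (f : I -> K) (A : {fset I}) :
  partial_sum f A = \sum_(i <- A) f i.
Proof. by rewrite /partial_sum big_seq_fsetE. Qed.

Lemma has_sumP (I : choiceType) (f : I -> K) (l : K) :
  has_sum f l <-> forall e : K, 0 < e -> exists A : {fset I},
    forall B, A `<=` B -> `|l - \sum_(i <- B) f i| < e.
Proof.
rewrite /has_sum; split=> [/cvgrPdist_lt H e e0|H].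
  have [A _ HA] := H e e0.
  by exists A => B AB; rewrite -partial_sumE; apply: HA.
apply/cvgrPdist_lt => e e0; have [A HA] := H e e0.
by exists A => // B /= AB; rewrite partial_sumE; apply: HA.
Qed.

Lemma has_sum_unique (I : choiceType) (f : I -> K) (l l' : K) :
  has_sum f l -> has_sum f l' -> l = l'.
Proof. by move=> h h'; apply: cvg_unique h h'. Qed.

Definition usum (I : choiceType) (f : I -> K) : K := summability.sum f.

Lemma has_sumE (I : choiceType) (f : I -> K) (l : K) :
  has_sum f l -> usum f = l.
Proof. by move=> h; apply: cvg_lim h. Qed.

Lemma eq_has_sum (I : choiceType) (f g : I -> K) (l : K) :
  f =1 g -> has_sum f l -> has_sum g l.
Proof. by move=> /funext ->. Qed.

Lemma has_sumD (I : choiceType) (f g : I -> K) (l l' : K) :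
  has_sum f l -> has_sum g l' -> has_sum (fun i => f i + g i) (l + l').
Proof.
move=> hf hg; rewrite /has_sum.
have -> : partial_sum (fun i => f i + g i) = partial_sum f \+ partial_sum g.
  by apply/funext => A /=; rewrite !partial_sumE big_split.
exact: cvgD.
Qed.

Lemma has_sumZ (I : choiceType) (c : K) (f : I -> K) (l : K) :
  has_sum f l -> has_sum (fun i => c * f i) (c * l).
Proof.
move=> hf; rewrite /has_sum.
have -> : partial_sum (fun i => c * f i) = (fun A => c * partial_sum f A).
  by apply/funext => A /=; rewrite !partial_sumE -mulr_sumr.
exact: cvgMr.
Qed.

Lemma has_sumN (I : choiceType) (f : I -> K) (l : K) :
  has_sum f l -> has_sum (fun i => - f i) (- l).
Proof.
by move=> /(has_sumZ (c := -1)); rewrite mulN1r; apply: eq_has_sum => i; rewrite mulN1r.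
Qed.

Lemma has_sumB (I : choiceType) (f g : I -> K) (l l' : K) :
  has_sum f l -> has_sum g l' -> has_sum (fun i => f i - g i) (l - l').
Proof. by move=> hf /has_sumN; apply: has_sumD. Qed.

Lemma has_sum_fset (I : choiceType) (f : I -> K) (A : {fset I}) :
  (forall i, i \notin A -> f i = 0) -> has_sum f (\sum_(i <- A) f i).
Proof.
move=> f0; apply/has_sumP => e e0; exists A => B AB.
rewrite (big_fset_incl _ AB) ?subrr ?normr0 // => i _ iA.
exact: f0.
Qed.

Lemma has_sum1 (I : choiceType) (i0 : I) (c : K) :
  has_sum (fun i => if i == i0 then c else 0) c.
Proof.
have -> : c = \sum_(i <- [fset i0]) if i == i0 then c else 0.
  by rewrite big_seq_fset1 eqxx.
rewrite [X in has_sum X](_ : _ = (fun i => if i == i0 then c else 0)); last first.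
  by rewrite big_seq_fset1 eqxx.
by apply: has_sum_fset => i; rewrite inE => /negPf ->.
Qed.

Lemma has_sum_fin (I : finType) (f : I -> K) : has_sum f (\sum_i f i).
Proof.
have -> : \sum_i f i = \sum_(i <- [fset i in I]) f i.
  rewrite -big_enum /=; apply: perm_big; apply: uniq_perm.
  - exact: enum_uniq.
  - exact: fset_uniq.
  - by move=> i; rewrite mem_enum !inE.
by apply: has_sum_fset => i; rewrite !inE.
Qed.

Lemma has_sum_bij (I J : choiceType) (h : J -> I) (k : I -> J) (f : I -> K) l :
  cancel h k -> cancel k h -> has_sum f l -> has_sum (f \o h) l.
Proof.
move=> hk kh /has_sumP H; apply/has_sumP => e e0.
have [A HA] := H e e0; exists [fset k i | i in A] => B AB.
have -> : \sum_(j <- B) (f \o h) j = \sum_(i <- [fset h j | j in B]) f i.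
  by rewrite big_imfset //= => x y _ _; apply: can_inj hk _ _.
apply: HA; apply/fsubsetP => i iA; apply/imfsetP; exists (k i) => //=.
by apply: (fsubsetP AB); apply/imfsetP; exists i.
Qed.

Lemma big_fsetM (I J : choiceType) (A : {fset I}) (B : {fset J}) (f : I * J -> K) :
  \sum_(ij <- A `*` B) f ij = \sum_(i <- A) \sum_(j <- B) f (i, j).
Proof. by rewrite big_imfset2 //= => -[? ?] [? ?] _ _ [-> ->]. Qed.

Lemma fset_sub_prod (I J : choiceType) (A : {fset I * J}) :
  A `<=` [fset ij.1 | ij in A] `*` [fset ij.2 | ij in A].
Proof.
apply/fsubsetP => -[i j] ijA; rewrite !inE /=.
by apply/andP; split; apply/imfsetP; exists (i, j).
Qed.

(** For a finite [B], one finite [J0] is large enough for all fibres over [B] and for [A]; the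
    partial sum over the rectangle is then close both to [l] and to the sum of [g] over [B]. *)
Lemma has_sum_fubini (I J : choiceType) (f : I * J -> K) l (g : I -> K) :
  has_sum f l -> (forall i, has_sum (fun j => f (i, j)) (g i)) -> has_sum g l.
Proof.
move=> /has_sumP H Hg; apply/has_sumP => e e0.
have e20 : 0 < e / 2 by rewrite divr_gt0.
have [A HA] := H _ e20; exists [fset ij.1 | ij in A] => B AB.
pose c := (size B).+1%:R : K.
have c0 : 0 < e / 2 / c by rewrite divr_gt0 // ltr0Sn.
have /choice [Ai HAi] : forall i, exists Ai : {fset J}, forall Bi, Ai `<=` Bi ->
    `|g i - \sum_(j <- Bi) f (i, j)| < e / 2 / c.
  by move=> i; move/has_sumP: (Hg i) => /(_ _ c0).
pose J0 := [fset ij.2 | ij in A] `|` \bigcup_(i <- B) Ai i.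
have AJ : A `<=` B `*` J0.
  apply: fsubset_trans (fset_sub_prod A) _; apply/fsubsetP => -[i j].
  rewrite !in_fsetM /= => /andP[iA jA]; rewrite (fsubsetP AB) //=.
  by rewrite in_fsetU jA.
have := HA _ AJ; rewrite big_fsetM.
move=> H1; rewrite [e]splitr.
rewrite -(subrKA (\sum_(i <- B) \sum_(j <- J0) f (i, j))).
apply: le_lt_trans (ler_normD _ _) _; apply: ltr_leD => //.
rewrite distrC -sumrB; apply: le_trans (ler_norm_sum _ _ _) _.
apply: (@le_trans _ _ (\sum_(i <- B) e / 2 / c)).
  rewrite big_seq [leRHS]big_seq; apply: ler_sum => i iB; apply/ltW/HAi.
  apply: fsubset_trans (fsubsetUr _ _).
  exact: (bigfcup_sup _ iB).
rewrite big_const_seq count_predT iter_addr_0 -[leLHS]mulr_natr.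
rewrite -mulrA; apply: ler_piMr; first exact: ltW.
by rewrite mulrC ler_pdivrMr ?ltr0Sn // mul1r ler_nat leqnSn.
Qed.

Lemma abs_summable_le (I : choiceType) (f g : I -> K) :
  (forall i, `|f i| <= `|g i|) -> abs_summable g -> abs_summable f.
Proof.
move=> fg [M HM]; exists M => A; apply: le_trans (HM A).
by apply: ler_sum => i _.
Qed.

Lemma abs_summableZ (I : choiceType) c (f : I -> K) :
  abs_summable f -> abs_summable (fun i => c * f i).
Proof.
move=> [M HM]; exists (`|c| * M) => A.
under eq_bigr do rewrite normrM.
by rewrite -mulr_sumr ler_wpM2l.
Qed.

Lemma abs_summable_inj (I J : choiceType) (h : J -> I) (f : I -> K) :
  injective h -> abs_summable f -> abs_summable (f \o h).
Proof.
move=> hI [M HM]; exists M => A.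
have -> : \sum_(j <- A) `|(f \o h) j| = \sum_(i <- [fset h j | j in A]) `|f i|.
  by rewrite big_imfset //= => x y _ _; apply: hI.
exact: HM.
Qed.

Lemma ler_sum_fsubset (I : choiceType) (A B : {fset I}) (g : I -> K) :
  (forall i, 0 <= g i) -> A `<=` B -> \sum_(i <- A) g i <= \sum_(i <- B) g i.
Proof.
move=> g0 AB; rewrite [leRHS](big_fsetID _ (fun i => i \in A)) /=.
have -> : [fset x | x in B & x \in A] = A.
  apply/fsetP => x; rewrite !inE /=.
  by apply/andP/idP => [[]//|xA]; split=> //; apply: (fsubsetP AB).
by rewrite lerDl sumr_ge0.
Qed.

Lemma abs_summable_prod (I J : choiceType) (f : I -> K) (g : J -> K) :
  abs_summable f -> abs_summable g ->
  abs_summable (fun ij : I * J => f ij.1 * g ij.2).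
Proof.
move=> [M HM] [N HN]; exists (M * N) => A.
apply: le_trans (ler_sum_fsubset _ (fset_sub_prod A)) _ => //.
rewrite big_fsetM /=.
under eq_bigr do under eq_bigr do rewrite normrM.
under eq_bigr do rewrite -mulr_sumr.
rewrite -mulr_suml; apply: ler_pM => //; exact: sumr_ge0.
Qed.

Lemma big_fset_iota (f : nat -> K) n :
  \sum_(i <- [fset i in iota 0 n]) f i = \sum_(0 <= i < n) f i.
Proof.
rewrite /index_iota subn0; apply: perm_big; apply: uniq_perm.
- exact: fset_uniq.
- exact: iota_uniq.
- by move=> i; rewrite !inE.
Qed.

Lemma fset_sub_iota (A : {fset nat}) :
  exists N, forall n, (N <= n)%N -> A `<=` [fset i in iota 0 n].
Proof.
exists (\max_(i <- A) i.+1)%N => n Nn; apply/fsubsetP => i iA.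
rewrite !inE mem_iota /= add0n; apply: leq_trans Nn.
exact: (@leq_bigmax_seq _ (enum_fset A) xpredT S i).
Qed.

Lemma has_sum_cvg_series (f : nat -> K) l :
  has_sum f l -> (fun n => \sum_(0 <= i < n) f i) @ \oo --> l.
Proof.
move=> /has_sumP H; apply/cvgrPdist_lt => e e0; have [A HA] := H e e0.
have [N HN] := fset_sub_iota A.
by exists N => // n /= Nn; rewrite -big_fset_iota; apply/HA/HN.
Qed.

Lemma geom_sum_le (a : K) n : 0 <= a -> a < 1 ->
  \sum_(0 <= i < n) a ^+ i <= (1 - a)^-1.
Proof.
move=> a0 a1; have b0 : 0 < 1 - a by rewrite subr_gt0.
have H : \sum_(0 <= i < n) a ^+ i * (1 - a) = 1 - a ^+ n.
  elim: n => [|n IH]; first by rewrite big_nil expr0 subrr.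
  by rewrite big_nat_recr //= IH exprS; ring.
by rewrite -[leRHS]mul1r ler_pdivlMr // mulr_suml H gerBl exprn_ge0.
Qed.

Lemma abs_summable_geom (a : K) : 0 <= a -> a < 1 ->
  abs_summable (fun n : nat => a ^+ n).
Proof.
move=> a0 a1; exists ((1 - a)^-1) => A; have [N HN] := fset_sub_iota A.
apply: le_trans (ler_sum_fsubset _ (HN N (leqnn N))) _ => //.
rewrite big_fset_iota.
under eq_bigr do rewrite normrX ger0_norm //.
exact: geom_sum_le.
Qed.

Lemma abs_summable_fin (I : finType) (f : I -> K) : abs_summable f.
Proof.
exists (\sum_i `|f i|) => A; rewrite big_uniq ?fset_uniq //= big_mkcond /=.
by apply: ler_sum => i _; case: ifP.
Qed.

Lemma abs_summable_geom_int (a : K) : 0 <= a -> a < 1 ->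
  abs_summable (fun j : int => a ^+ absz j).
Proof.
move=> a0 a1.
have H := abs_summable_prod (abs_summable_geom a0 a1)
  (abs_summable_fin (fun=> 1) (I := bool)).
have inj : injective (fun j : int => (absz j, 0 <= j)).
  by move=> i j [] h; lia.
apply: abs_summable_le (abs_summable_inj inj H) => j /=.
by rewrite mulr1.
Qed.

Lemma has_sum_norm_le (I : choiceType) (f : I -> K) l M :
  (forall A : {fset I}, `|\sum_(i <- A) f i| <= M) -> has_sum f l -> `|l| <= M.
Proof.
move=> HM /has_sumP H; apply/ler_addgt0Pr => e e0; have [A HA] := H e e0.
rewrite -(subrK (\sum_(i <- A) f i) l) addrC.
apply: le_trans (ler_normD _ _) _; apply: lerD => //.
exact/ltW/HA.
Qed.

Lemma has_sum_ge (I : choiceType) (g : I -> K) l (A : {fset I}) :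
  (forall i, 0 <= g i) -> has_sum g l -> \sum_(i <- A) g i <= `|l|.
Proof.
move=> g0 /has_sumP H; apply/ler_addgt0Pr => e e0; have [B HB] := H e e0.
have := HB _ (fsubsetUr A B); set S := \sum_(i <- _) _ => HS.
apply: (@le_trans _ _ S); first exact/ler_sum_fsubset/fsubsetUl.
rewrite -[leLHS]ger0_norm ?sumr_ge0 // -[S](subrK l) addrC.
apply: le_trans (ler_normD _ _) _; apply: lerD => //.
by rewrite distrC ltW.
Qed.

(** Dominated convergence for series: a finite [A] carries all but e/4 of the majorant, so the tails
    of [s n] and [t] are each at most e/4, and on [A] the convergence is termwise. *)
Lemma tannery (I : choiceType) (f : nat -> I -> K) (g h : I -> K) s t G :
  has_sum g G -> (forall n i, `|f n i| <= g i) ->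
  (forall i, f ^~ i @ \oo --> h i) ->
  (forall n, has_sum (f n) (s n)) -> has_sum h t -> s @ \oo --> t.
Proof.
move=> HG fg fh Hs Ht; apply/cvgrPdist_lt => e e0.
have e40 : 0 < e / 4 by rewrite divr_gt0.
have [A HA] := (has_sumP _ _).1 HG _ e40.
have {}HA := HA A (fsubset_refl A).
have indA (u : I -> K) v : has_sum u v ->
    has_sum (fun i => if i \in A then 0 else u i) (v - \sum_(i <- A) u i).
  move=> Hu; have H := has_sum_fset (f := fun i => if i \in A then u i else 0) (A := A).
  have {}H : has_sum (fun i => if i \in A then u i else 0) (\sum_(i <- A) u i).
    rewrite (eq_big_seq (fun i => if i \in A then u i else 0)).
      by apply: H => i /negPf ->.
    by move=> i ->.
  apply: eq_has_sum (has_sumB Hu H) => i.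
  by case: ifP; rewrite ?subrr ?subr0.
have tail (u : I -> K) v : (forall i, `|u i| <= g i) -> has_sum u v ->
    `|v - \sum_(i <- A) u i| <= e / 4.
  move=> ug Hu; apply: has_sum_norm_le (indA _ _ Hu) => B.
  apply: le_trans (ler_norm_sum _ _ _) _; apply: le_trans (ltW HA).
  apply: le_trans (has_sum_ge B _ (indA _ _ HG)).
    by apply: ler_sum => i _; case: ifP => _; rewrite ?normr0.
  by move=> i; case: ifP => // _; apply: le_trans (ug i).
have hg i : `|h i| <= g i.
  apply/ler_addgt0Pr => d d0.
  have /cvgrPdist_lt /(_ d d0) [N _ HN] := fh i.
  have := HN N (leqnn N); rewrite /= => hN.
  rewrite -(subrK (f N i) (h i)) addrC; apply: le_trans (ler_normD _ _) _.
  by apply: lerD => //; apply: ltW.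
have cvgA : (fun n => \sum_(i <- A) f n i) @ \oo --> \sum_(i <- A) h i.
  elim: (enum_fset A) => [|i B IH].
    rewrite big_nil (_ : (fun n => _) = fun=> 0); first exact: cvg_cst.
    by apply/funext => n; rewrite big_nil.
  rewrite big_cons (_ : (fun n => _) = f ^~ i \+ (fun n => \sum_(j <- B) f n j)).
    exact: cvgD.
  by apply/funext => n; rewrite big_cons.
have /cvgrPdist_lt /(_ _ e40) [N _ HN] := cvgA.
exists N => // n Nn /=.
have h1 := tail _ _ hg Ht; have h2 := tail _ _ (fg n) (Hs n).
have {}HN : `|\sum_(i <- A) h i - \sum_(i <- A) f n i| < e / 4 by exact: HN.
have -> : t - s n = (t - \sum_(i <- A) h i)
  + (\sum_(i <- A) h i - \sum_(i <- A) f n i) - (s n - \sum_(i <- A) f n i).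
  by ring.
apply: le_lt_trans (ler_normB _ _) _.
apply: le_lt_trans (lerD (ler_normD _ _) (lexx _)) _.
have lt34 : e / 4 + e / 4 + e / 4 < e.
  rewrite [ltRHS](_ : _ = e / 4 + e / 4 + e / 4 + e / 4); last by field.
  by rewrite ltrDl.
apply: lt_trans lt34; apply: ltr_leD => //.
exact: ler_ltD.
Qed.

End HasSum.

(** * Absolutely summable complex families *)

Section Complex.
Variable R : realType.

Lemma bounded_has_sum (I : choiceType) (g : I -> R) (M : R) :
  (forall i, 0 <= g i) -> (forall A : {fset I}, \sum_(i <- A) g i <= M) ->
  exists l, has_sum (fun i => (g i)%:C%C) l.
Proof.
move=> g0 HM; pose S := [set x : R | exists A : {fset I}, x = \sum_(i <- A) g i].
have hS : has_sup S.
  split; first by exists (\sum_(i <- fset0) g i); exists fset0.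
  by exists M => _ [A ->].
exists (sup S)%:C%C; apply/has_sumP => e; move: (e : R[i]) => {}e e0.
(* In [R[i]], [0 < e] forces [e] to be real, so the estimate takes place in [R]. *)
have : (complex.Re e)%:C%C = e by rewrite RRe_real // ger0_real // ltW.
move: (complex.Re e) => d de; rewrite -de in e0 *; rewrite ltcR in e0.
have [_ [A ->] HA] := sup_adherent e0 hS.
exists A => B AB; rewrite -raddf_sum -raddfB /=.
have h1 : \sum_(i <- B) g i <= sup S by apply: sup_upper_bound => //; exists B.
have h2 := ler_sum_fsubset g0 AB.
rewrite ger0_norm ?ler0c ?ltcR; lra.
Qed.

(** The real part is the difference of |f| + Re f and |f|, nonnegative families with bounded finite
    sums, each summed by a supremum; likewise for the imaginary part. *)
Lemma abs_summable_has_sum (I : choiceType) (f : I -> R[i]) :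
  abs_summable f -> exists l, has_sum f l.
Proof.
move=> [M HM].
have HM' (A : {fset I}) : \sum_(i <- A) Normc.normc (f i) <= complex.Re M.
  have := HM A; rewrite lecE => /andP[_]; apply: le_trans.
  rewrite (_ : \sum_(i <- A) `|f i| = (\sum_(i <- A) Normc.normc (f i))%:C%C) //.
  by rewrite raddf_sum; apply: eq_bigr => i _; case: (f i).
have part (g : I -> R) : (forall i, `|g i| <= Normc.normc (f i)) ->
    exists l, has_sum (fun i => (g i)%:C%C) l.
  move=> gf.
  have [i|A|l1 H1] := @bounded_has_sum I (fun i => Normc.normc (f i) + g i)
    (complex.Re M + complex.Re M).
  - by have := gf i; rewrite ler_norml => /andP[]; lra.
  - rewrite big_split /=; apply: lerD => //; apply: le_trans (HM' A).
    by apply: ler_sum => i _; apply: le_trans (gf i); apply: ler_norm.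
  have [i|A|l2 H2] := @bounded_has_sum I (fun i => Normc.normc (f i)) (complex.Re M).
  - by apply: le_trans (gf i).
  - exact: HM'.
  exists (l1 - l2); apply: eq_has_sum (has_sumB H1 H2) => i.
  by rewrite -raddfB /= addrC addKr.
have [i|l1 H1] := part (fun i => complex.Re (f i)).
  case: (f i) => a b /=; rewrite -sqrtr_sqr ler_sqrt; nra.
have [i|l2 H2] := part (fun i => complex.Im (f i)).
  case: (f i) => a b /=; rewrite -sqrtr_sqr ler_sqrt; nra.
exists (l1 + 'i%C * l2); apply: eq_has_sum (has_sumD H1 (has_sumZ (c := 'i%C) H2)).
by move=> i; rewrite -complexE.
Qed.

End Complex.

Section SumTransfer.
Variable R : realType.

(** Shifting a sum over cones leaves boundary terms on a line of the index plane; this places a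
    one-variable sum on such a line. *)
Lemma has_sum_line (J : choiceType) (I : choiceType) (g : I -> R[i]) (j0 : J) l :
  abs_summable g -> has_sum g l ->
  has_sum (fun p : I * J => g p.1 * (p.2 == j0)%:R) l.
Proof.
move=> ag Hg.
have aj : abs_summable (fun j => (j == j0)%:R : R[i]).
  exists 1 => A; rewrite (eq_bigr (fun j => if j == j0 then 1 else 0)); last first.
    by move=> j _; case: eqP; rewrite ?normr1 ?normr0.
  have h := @has_sum1 _ J j0 (1 : R[i]).
  apply: le_trans (has_sum_ge A _ h) _; last by rewrite normr1.
  by move=> j; case: eqP.
have [L HL] := abs_summable_has_sum (abs_summable_prod ag aj).
suff <- : L = l by [].
apply: has_sum_unique Hg; apply: has_sum_fubini HL _ => i /=.
apply: eq_has_sum (@has_sum1 _ J j0 (g i)) => j.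
by case: eqP; rewrite ?mulr1 ?mulr0.
Qed.

Lemma has_sum_swap (I J : choiceType) (f : I * J -> R[i]) l :
  has_sum f l -> has_sum (fun p => f (p.2, p.1)) l.
Proof.
move=> H; apply: eq_has_sum (has_sum_bij (h := fun p : J * I => (p.2, p.1))
  (k := fun p : I * J => (p.2, p.1)) _ _ H) => //; by case.
Qed.

(* If [c = 0] both sides vanish, so no summability of [f] is needed. *)
Lemma usum_of_has_sumZ (I : choiceType) (c l : R[i]) (f : I -> R[i]) :
  has_sum (fun i => c * f i) l -> l = c * usum f.
Proof.
have [->|c0] := eqVneq c 0.
  move=> H; rewrite mul0r; apply: has_sum_unique H _.
  have := has_sum_fset (f := fun i => 0 * f i) (A := fset0).
  rewrite big_seq_fset0; apply => i _; exact: mul0r.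
move=> /(has_sumZ (c := c^-1)) H.
rewrite (has_sumE (l := c^-1 * l)) ?mulVKf //.
by apply: eq_has_sum H => i; rewrite mulKf.
Qed.

End SumTransfer.

(** * The triple product *)

Section QPoch.
Variable R : realType.
Implicit Types a q z : R[i].

Lemma normrC z : `|z| = (Normc.normc z)%:C%C.
Proof. by case: z. Qed.

Lemma normc_lt1 q : (`|q| < 1) = (Normc.normc q < 1).
Proof. by rewrite normrC -(ltcR _ 1). Qed.

Lemma normc_ge0 z : 0 <= Normc.normc z.
Proof. by case: z => x y; exact: sqrtr_ge0. Qed.

Lemma normcX z n : Normc.normc (z ^+ n) = Normc.normc z ^+ n.
Proof.
by elim: n => [|n IH]; rewrite ?expr0 ?Normc.normc1 // !exprS Normc.normcM IH.
Qed.

Lemma qpochS a q n : qpoch a q n.+1 = qpoch a q n * (1 - a * q ^+ n).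
Proof. by rewrite /qpoch big_nat_recr. Qed.

Lemma qpoch0 a q : qpoch a q 0 = 1.
Proof. by rewrite /qpoch big_nil. Qed.

Lemma qpochD a q m n : qpoch a q (m + n) = qpoch a q m * qpoch (a * q ^+ m) q n.
Proof.
elim: n => [|n IH]; first by rewrite addn0 qpoch0 mulr1.
by rewrite addnS !qpochS IH mulrA exprD mulrA.
Qed.

(** Each factor satisfies |1 - a q^k| <= 1 + |a| |q|^k <= exp(|a| |q|^k), and the exponents form a
    geometric series. *)
Lemma qpoch_bounded a q : `|q| < 1 ->
  exists M : R, forall n, Normc.normc (qpoch a q n) <= M.
Proof.
rewrite normc_lt1 => q1; have q0 := normc_ge0 q.
exists (expR (Normc.normc a * (1 - Normc.normc q)^-1)) => n.
apply: (@le_trans _ _ (expR (Normc.normc a * \sum_(0 <= k < n) Normc.normc q ^+ k))).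
  elim: n => [|n IH].
    by rewrite qpoch0 big_nil mulr0 expR0 Normc.normc1.
  rewrite qpochS Normc.normcM big_nat_recr //= mulrDr expRD.
  apply: ler_pM IH _; rewrite ?normc_ge0 //.
  apply: le_trans (expR_ge1Dx _).
  apply: le_trans (le_normcD _ _) _.
  by rewrite Normc.normc1 normcN Normc.normcM normcX.
by rewrite ler_expR ler_wpM2l ?normc_ge0 // geom_sum_le.
Qed.

(** Weierstrass's inequality: a product of factors 1 - x_k is at least 1 minus the sum of the x_k =
    |a| |q|^k, here at most 1/2. *)
Lemma qpoch_lower_bound a q n : `|q| < 1 ->
  2 * Normc.normc a <= 1 - Normc.normc q -> 1 <= 2 * Normc.normc (qpoch a q n).
Proof.
rewrite normc_lt1 => q1 ha; have q0 := normc_ge0 q; have a0 := normc_ge0 a.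
pose S n := Normc.normc a * \sum_(0 <= k < n) Normc.normc q ^+ k.
have S2 m : S m <= 2^-1.
  apply: (@le_trans _ _ (Normc.normc a * (1 - Normc.normc q)^-1)).
    by rewrite ler_wpM2l // geom_sum_le.
  rewrite ler_pdivrMr ?subr_gt0 //; lra.
suff : 1 - S n <= Normc.normc (qpoch a q n) by have := S2 n; lra.
elim: n => [|n IH]; first by rewrite /S big_nil mulr0 qpoch0 Normc.normc1 subr0.
rewrite qpochS Normc.normcM.
have Sn : S n.+1 = S n + Normc.normc a * Normc.normc q ^+ n.
  by rewrite /S big_nat_recr //= mulrDr.
have h0 : 0 <= Normc.normc a * Normc.normc q ^+ n.
  by rewrite mulr_ge0 // exprn_ge0.
have h1 : 1 - Normc.normc a * Normc.normc q ^+ n <= Normc.normc (1 - a * q ^+ n).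
  rewrite lerBlDr -normcX -Normc.normcM.
  by apply: le_trans (le_normcD _ _); rewrite subrK Normc.normc1.
have := S2 n.+1; have := S2 n; rewrite {}Sn => h2 h3.
have S0 : 0 <= S n by rewrite mulr_ge0 // sumr_ge0 // => i _; rewrite exprn_ge0.
apply: (@le_trans _ _ ((1 - S n) * (1 - Normc.normc a * Normc.normc q ^+ n))).
  nra.
by apply: ler_pM => //; lra.
Qed.

(** Consecutive products differ by - a q^n times a bounded quantity, so an absolutely convergent
    series telescopes to the limit. *)
Lemma qpoch_cvg a q : `|q| < 1 -> qpoch a q @ \oo --> qpoch_inf a q.
Proof.
move=> q1; have [M HM] := qpoch_bounded a q1.
have [l Hl] : exists l, has_sum (fun n => - a * q ^+ n * qpoch a q n) l.
  apply: abs_summable_has_sum.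
  have := abs_summable_geom (normr_ge0 q) q1.
  move=> /(abs_summableZ (`|a| * M%:C%C)); apply: abs_summable_le => n.
  rewrite !normrM normrN !normrX !normr_id -!mulrA; apply: ler_wpM2l => //.
  rewrite mulrC; apply: ler_wpM2r; first exact: exprn_ge0.
  by rewrite normrC ger0_norm ?ler0c ?lecR ?HM // (le_trans _ (HM 0%N)) ?normc_ge0.
have H : qpoch a q @ \oo --> 1 + l.
  rewrite (_ : qpoch a q = (fun n => 1 + \sum_(0 <= i < n) - a * q ^+ i * qpoch a q i)).
    by apply: cvgD (has_sum_cvg_series Hl); exact: cvg_cst.
  apply/funext => n; elim: n => [|n IH]; first by rewrite qpoch0 big_nil addr0.
  by rewrite big_nat_recr //= addrA -IH qpochS; ring.
by rewrite /qpoch_inf (cvg_lim _ H).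
Qed.

(** Once finitely many nonzero factors are split off, a q^N is small enough for [qpoch_lower_bound]
    to keep the tail away from 0. *)
Lemma qpoch_inf_neq0 a q : `|q| < 1 -> (forall k : nat, 1 - a * q ^+ k != 0) ->
  qpoch_inf a q != 0.
Proof.
move=> q1 nz; have q1' := q1; rewrite normc_lt1 in q1'.
have [N HN] : exists N, 2 * Normc.normc (a * q ^+ N) <= 1 - Normc.normc q.
  have := cvg_geometric (Normc.normc a) (z := Normc.normc q).
  rewrite ger0_norm ?normc_ge0 // => /(_ q1') /cvgrPdist_lt.
  have e0 : 0 < (1 - Normc.normc q) / 2 by rewrite divr_gt0 ?subr_gt0.
  move=> /(_ _ e0) [N _ /(_ N (leqnn N))] /=.
  rewrite sub0r normrN ger0_norm; last by rewrite mulr_ge0 ?exprn_ge0 ?normc_ge0.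
  by move=> h; exists N; rewrite Normc.normcM normcX; lra.
have nzN : qpoch a q N != 0.
  by elim: N {HN} => [|N IH]; rewrite ?qpoch0 ?oner_eq0 // qpochS mulf_neq0.
have E : qpoch_inf a q = qpoch a q N * qpoch_inf (a * q ^+ N) q.
  have H1 := qpoch_cvg (a := a) q1.
  have H2 : (fun n => qpoch a q (n + N)%N) @ \oo --> qpoch_inf a q.
    by rewrite cvg_shiftn.
  have H3 : (fun n => qpoch a q N * qpoch (a * q ^+ N) q n) @ \oo -->
      qpoch a q N * qpoch_inf (a * q ^+ N) q.
    by apply: cvgMr; exact: qpoch_cvg.
  have fE : (fun n => qpoch a q (n + N)%N) =
      (fun n => qpoch a q N * qpoch (a * q ^+ N) q n).
    by apply/funext => n; rewrite addnC qpochD.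
  rewrite fE in H2; exact: (cvg_unique _ H2 H3).
rewrite E mulf_neq0 //; apply/eqP => l0.
have /cvgrPdist_lt /(_ 2^-1) := qpoch_cvg (a := a * q ^+ N) q1.
rewrite l0 => /(_ _) [|n _ /(_ n (leqnn n))] /=.
  by rewrite invr_gt0.
rewrite sub0r normrN normrC.
have := qpoch_lower_bound n q1 HN.
set x := Normc.normc _ => h.
rewrite (_ : 2^-1 = (2^-1 : R)%:C%C) ?ltcR; last by rewrite fmorphV rmorphMn.
lra.
Qed.

End QPoch.

Lemma binom2_double (n : int) : 2 * binom2 n = n * (n - 1).
Proof.
rewrite /binom2 mulrC divzK //; have [k [->|->]] : exists k, n = 2 * k \/ n = 2 * k + 1.
- by exists (n %/ 2)%Z; lia.
- by rewrite -mulrA dvdz_mulr.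
- by rewrite addrK mulrCA dvdz_mulr.
Qed.

Lemma binom2D1 (n : int) : binom2 (n + 1) = binom2 n + n.
Proof. have := binom2_double n; have := binom2_double (n + 1); lia. Qed.

Lemma normrXz (K : numFieldType) (x : K) (n : int) : `|x ^ n| = `|x| ^ n.
Proof. by case: n => n; rewrite /= ?NegzE -?exprnN ?normfV ?normrX // -!exprnP normrX. Qed.

Lemma ler_expz_le1 (K : numFieldType) (x : K) (m n : int) :
  0 < x -> x <= 1 -> m <= n -> x ^ n <= x ^ m.
Proof.
move=> x0 x1 mn; rewrite -(subrKC m n) expfzDr ?gt_eqF //.
apply: ler_piMr; first by rewrite exprz_ge0 // ltW.
rewrite -subr_ge0 in mn; case: (n - m) mn => // k _.
by rewrite -exprnP exprn_ile1 // ltW.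
Qed.

Lemma normN1z (K : numFieldType) (n : int) : `|(-1) ^ n : K| = 1.
Proof. by rewrite normrXz normrN1 exp1rz. Qed.

Lemma cvg_addz (K : numFieldType) (g : int -> K) (l : K) (j : int) :
  (fun n : nat => g n%:Z) @ \oo --> l -> (fun n : nat => g (n%:Z + j)) @ \oo --> l.
Proof.
move=> /cvgrPdist_lt H; apply/cvgrPdist_lt => e e0; have [N _ HN] := H e e0.
exists (N + absz j)%N => // n /= Nn.
have -> : n%:Z + j = Posz (absz (n%:Z + j)) by lia.
by apply: HN; rewrite /=; lia.
Qed.

Lemma cvg_double (K : numFieldType) (u : nat -> K) (l : K) :
  u @ \oo --> l -> (fun n => u (2 * n)%N) @ \oo --> l.
Proof.
move=> /cvgrPdist_lt H; apply/cvgrPdist_lt => e e0; have [N _ HN] := H e e0.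
by exists N => // n /= Nn; apply: HN; rewrite /=; lia.
Qed.

Lemma cvgMVV (K : numFieldType) (u v w : nat -> K) (l : K) : l != 0 ->
  u @ \oo --> l -> v @ \oo --> l^-1 -> w @ \oo --> l^-1 ->
  (fun n => u n * (v n * w n)) @ \oo --> l^-1.
Proof.
move=> l0 hu hv hw; rewrite -[X in _ --> X](mulVKf l0).
by apply: cvgM => //; apply: cvgM.
Qed.

(** * Convergence by comparison of integer exponents *)

Section Growth.
Variables (R : realType) (q : R[i]).
Hypotheses (q0 : q != 0) (q1 : `|q| < 1).

(** Reduces convergence to an integer inequality between exponents. The alternative [f i = 0] covers
    the indices outside the cones. *)
Lemma abs_summable_expz_le (I : choiceType) (N : I -> int) (k : int) (f : I -> R[i]) :
  abs_summable (fun i => q ^ N i) ->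
  (forall i, f i = 0 \/ exists2 e, `|f i| <= `|q| ^ e & N i <= e + k) ->
  abs_summable f.
Proof.
move=> HN Hf; apply: abs_summable_le (abs_summableZ (q ^ (- k)) HN) => i.
have [->|[e he hN]] := Hf i; first by rewrite normr0.
apply: le_trans he _; rewrite -expfzDr // normrXz.
apply: ler_expz_le1; [by rewrite normr_gt0|exact: ltW|lia].
Qed.

Lemma abs_summable_expz1 : abs_summable (fun j : int => q ^ `|j|).
Proof.
apply: abs_summable_le (abs_summable_geom_int (normr_ge0 q) q1) => j.
by rewrite normrXz normrX normr_id.
Qed.

Lemma abs_summable_expz2 : abs_summable (fun j : int * int => q ^ (`|j.1| + `|j.2|)).
Proof.
apply: abs_summable_le (abs_summable_prod abs_summable_expz1 abs_summable_expz1).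
by move=> j; rewrite expfzDr.
Qed.

Lemma abs_summable_expz4 : abs_summable (fun j : (int * int) * (int * int) =>
  q ^ (`|j.1.1| + `|j.1.2| + `|j.2.1| + `|j.2.2|)).
Proof.
apply: abs_summable_le (abs_summable_prod abs_summable_expz2 abs_summable_expz2).
by move=> j; rewrite -expfzDr // !addrA.
Qed.

Lemma norm_le_expz (z : R[i]) : exists N : nat, forall n : int, N%:Z <= n -> `|z| <= `|q| ^ (- n).
Proof.
have q1' := q1; rewrite normc_lt1 in q1'.
have q0' : 0 < `|q| by rewrite normr_gt0.
have := cvg_geometric (Normc.normc z) (z := Normc.normc q).
rewrite ger0_norm ?normc_ge0 // => /(_ q1') /cvgrPdist_lt /(_ _ ltr01) [N _ HN].
exists N => -[n|//] Nn; have := HN n Nn.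
rewrite /= sub0r normrN ger0_norm ?mulr_ge0 ?exprn_ge0 ?normc_ge0 // -normcX -Normc.normcM.
rewrite -exprnN -[leRHS]mul1r ler_pdivlMr ?exprn_gt0 // -normrX -normrM => h.
by apply: ltW; rewrite normc_lt1.
Qed.

(** Turns powers of an arbitrary base into powers of |q|. The constant is large enough for both z
    and its inverse, hence for both signs of j. *)
Lemma norm_expz_growth (z : R[i]) : z != 0 ->
  exists2 c : int, 0 <= c & forall j, `|z ^ j| <= `|q| ^ (- c * `|j|).
Proof.
move=> z0; have [N1 H1] := norm_le_expz z; have [N2 H2] := norm_le_expz z^-1.
exists (N1%:Z + N2%:Z) => // j; rewrite -exprz_exp normrXz.
have {}H1 := H1 (N1%:Z + N2%:Z); have {}H2 := H2 (N1%:Z + N2%:Z).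
case: j => n.
  by rewrite -!exprnP; apply: lerXn2r; rewrite ?nnegrE ?exprz_ge0 ?H1 //; lia.
rewrite NegzE normrN /= -exprnN -exprVn -normfV -exprnP.
by apply: lerXn2r; rewrite ?nnegrE ?exprz_ge0 ?H2 //; lia.
Qed.

End Growth.

(** * The triple product as a limit of its finite form *)

Section JTP.
Variables (R : realType) (Q z : R[i]).
Hypotheses (Q0 : Q != 0) (Q1 : `|Q| < 1) (z0 : z != 0).

Definition theta_term (j : int) : R[i] := (-1) ^ j * Q ^ binom2 j * z ^ j.

Lemma N1neq0 : (-1 : R[i]) != 0. Proof. by rewrite oppr_eq0 oner_eq0. Qed.

Lemma theta_termD1 j : theta_term (j + 1) = - (Q ^ j * z * theta_term j).
Proof.
rewrite /theta_term binom2D1 !(expfzDr _ _ N1neq0) !(expfzDr _ _ Q0) !(expfzDr _ _ z0).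
rewrite !expr1z; ring.
Qed.

Lemma abs_summable_theta_term : abs_summable theta_term.
Proof.
have [c c0 Hc] := norm_expz_growth Q0 Q1 z0.
apply: (abs_summable_expz_le Q0 Q1 (k := (c + 2) * (c + 2)) (abs_summable_expz1 Q1)) => j.
right; exists (binom2 j - c * `|j|).
  rewrite /theta_term !normrM normN1z mul1r normrXz -mulNr expfzDr ?normr_eq0 //.
  by apply: ler_wpM2l => //; rewrite exprz_ge0.
have := binom2_double j; nia.
Qed.

(* Extended by [0] to negative integers, so that [inv_qfactD1] has no boundary case. *)
Definition inv_qfact (k : int) : R[i] := if k is Posz n then (qpoch Q Q n)^-1 else 0.

Lemma subr_expS_neq0 n : 1 - Q * Q ^+ n != 0.
Proof.
rewrite -exprS subr_eq0; apply/eqP => /(congr1 Num.norm) /eqP.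
by rewrite normr1 normrX gt_eqF // exprn_ilt1.
Qed.

Lemma qpoch_infQ_neq0 : qpoch_inf Q Q != 0.
Proof. by apply: qpoch_inf_neq0 => // n; exact: subr_expS_neq0. Qed.

Lemma inv_qfactD1 (k : int) : inv_qfact k = (1 - Q * Q ^ k) * inv_qfact (k + 1).
Proof.
case: k => [n|[|n]].
- rewrite /= addn1 qpochS invfM mulrA mulrAC mulfV ?mul1r //; exact: subr_expS_neq0.
- by rewrite exprN1 divff // subrr mul0r.
- by rewrite (_ : Negz n.+1 + 1 = Negz n) ?mulr0 //; lia.
Qed.

(** The Gaussian binomial coefficient of 2n over n + j in base [Q]; the convention on [inv_qfact]
    makes it 0 for |j| > n. *)
Definition jacobi_coef (n : nat) (j : int) : R[i] :=
  qpoch Q Q (2 * n) * (inv_qfact (n%:Z - j) * inv_qfact (n%:Z + j)).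

(** Pascal's rule for Gaussian binomials applied twice. With the inverse factorials reduced to the
    arguments [a + 1] and [b + 1], it is a rational identity in Q, Q^a and Q^b. *)
Lemma jacobi_coefS n j : jacobi_coef n.+1 j = (1 + Q ^+ (2 * n).+1) * jacobi_coef n j
  + Q ^ (n%:Z - j + 1) * jacobi_coef n (j - 1) + Q ^ (n%:Z + j + 1) * jacobi_coef n (j + 1).
Proof.
rewrite /jacobi_coef mulnS !addSn add0n !qpochS.
have [-> ->] : n.+1%:Z - j = n%:Z - j + 1 /\ n.+1%:Z + j = n%:Z + j + 1 by lia.
have [-> ->] : n%:Z - (j - 1) = n%:Z - j + 1 /\ n%:Z + (j + 1) = n%:Z + j + 1 by lia.
have [-> ->] : n%:Z - (j + 1) = n%:Z - j - 1 /\ n%:Z + (j - 1) = n%:Z + j - 1 by lia.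
have -> : Q ^+ (2 * n) = Q ^ (n%:Z - j) * Q ^ (n%:Z + j).
  by rewrite -expfzDr // exprnP; congr (_ ^ _); lia.
have E : Q ^+ (2 * n).+1 = Q * (Q ^ (n%:Z - j) * Q ^ (n%:Z + j)).
  by rewrite exprS -expfzDr // exprnP; congr (_ * _ ^ _); lia.
rewrite E.
move: (n%:Z - j) (n%:Z + j) => a b.
rewrite !(inv_qfactD1 (_ - 1)) !subrK (inv_qfactD1 a) (inv_qfactD1 b).
rewrite !(expfzDr _ _ Q0) expr1z exprN1.
by field.
Qed.

(** The step to n + 1 multiplies by (1 - z Q^n)(1 - Q^(n+1)/z), whose terms keep j or shift it by
    one either way: these are the terms of [jacobi_coefS]. *)
Lemma finite_jacobi n :
  has_sum (fun j => theta_term j * jacobi_coef n j) (qpoch z Q n * qpoch (Q / z) Q n).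
Proof.
elim: n => [|n IH].
  rewrite !qpoch0 mulr1; apply: eq_has_sum (@has_sum1 _ int 0 1) => j.
  rewrite /jacobi_coef muln0 qpoch0 mul1r sub0r add0r; case: eqVneq => [->|j0].
    by rewrite /theta_term /binom2 /= qpoch0 invr1 !mulr1.
  by case: j j0 => [[|n]|n] _ //=; rewrite ?mul0r ?mulr0.
have H1 := has_sumZ (c := 1 + Q ^+ (2 * n).+1) IH.
have H2 := has_sumZ (c := - (z * Q ^+ n))
  (has_sum_bij (fun j => subrK 1 j) (fun j => addrK 1 j) IH).
have H3 := has_sumZ (c := - (Q ^+ n.+1 / z))
  (has_sum_bij (fun j => addrK 1 j) (fun j => subrK 1 j) IH).
have -> : qpoch z Q n.+1 * qpoch (Q / z) Q n.+1 =
    (1 + Q ^+ (2 * n).+1) * (qpoch z Q n * qpoch (Q / z) Q n)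
    + - (z * Q ^+ n) * (qpoch z Q n * qpoch (Q / z) Q n)
    + - (Q ^+ n.+1 / z) * (qpoch z Q n * qpoch (Q / z) Q n).
  have -> : Q ^+ (2 * n).+1 = Q * (Q ^+ n * Q ^+ n).
    by rewrite exprS mul2n -addnn exprD.
  by rewrite !qpochS exprS; field.
apply: eq_has_sum (has_sumD (has_sumD H1 H2) H3) => j.
rewrite /= jacobi_coefS theta_termD1.
have -> : theta_term j = - (Q ^ (j - 1) * z * theta_term (j - 1)).
  by rewrite -theta_termD1 subrK.
have -> : Q ^ (n%:Z - j + 1) = Q ^+ n / Q ^ (j - 1).
  by rewrite invr_expz exprnP -expfzDr //; congr (_ ^ _); lia.
have -> : Q ^ (n%:Z + j + 1) = Q ^+ n.+1 * Q ^ j.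
  by rewrite exprnP -expfzDr //; congr (_ ^ _); lia.
have Qj : Q ^ (j - 1) != 0 by exact: expfz_neq0.
move: (theta_term (j - 1)) => u; move: (Q ^ (j - 1)) Qj => v v0.
by field; rewrite z0 v0.
Qed.

Lemma cvg_qpochV :
  (fun n => (qpoch Q Q n)^-1) @ \oo --> (qpoch_inf Q Q)^-1.
Proof. by apply: cvgV; [exact: qpoch_infQ_neq0|exact: qpoch_cvg]. Qed.

Lemma cvg_inv_qfact (j : int) :
  (fun n : nat => inv_qfact (n%:Z + j)) @ \oo --> (qpoch_inf Q Q)^-1.
Proof.
exact: (@cvg_addz _ inv_qfact _ j cvg_qpochV).
Qed.

Lemma inv_qfact_bounded : exists M : R[i], forall k, `|inv_qfact k| <= M.
Proof.
have /cvg_seq_bounded /pinfty_ex_gt0 [M M0 /= HM] : cvgn (fun n => (qpoch Q Q n)^-1).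
  by apply/cvg_ex; exists (qpoch_inf Q Q)^-1; exact: cvg_qpochV.
exists M => -[n|n] /=; last by rewrite normr0 ltW.
exact: HM.
Qed.

Lemma qpochQ_bounded : exists M : R[i], forall n, `|qpoch Q Q n| <= M.
Proof.
have [M HM] := qpoch_bounded Q Q1; exists M%:C%C => n.
by rewrite normrC lecR.
Qed.

(** The Gaussian binomials in [finite_jacobi] are bounded uniformly in n and j and tend to 1/(Q;
    Q)_oo, which accounts for the third factor of [theta]. *)
Lemma jacobi_triple_product : has_sum theta_term (theta z Q).
Proof.
have [t Ht] := abs_summable_has_sum abs_summable_theta_term.
have [B HB] := inv_qfact_bounded; have [M HM] := qpochQ_bounded.
have L0 := qpoch_infQ_neq0.
have B0 : 0 <= B by apply: le_trans (HB 0).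
have M0 : 0 <= M by apply: le_trans (HM 0%N).
have [g Hg] : exists g, has_sum (fun j => M * (B * B) * `|theta_term j|) g.
  apply: abs_summable_has_sum; apply: abs_summableZ.
  by apply: abs_summable_le abs_summable_theta_term => j; rewrite normr_id.
have Hlim : (fun n => qpoch z Q n * qpoch (Q / z) Q n) @ \oo -->
    (qpoch_inf Q Q)^-1 * t.
  apply: (tannery Hg (f := fun n j => theta_term j * jacobi_coef n j)
    (h := fun j => (qpoch_inf Q Q)^-1 * theta_term j)).
  - move=> n j; rewrite mulrC normrM ler_wpM2r // /jacobi_coef !normrM.
    by rewrite !ler_pM // ?mulr_ge0.
  - move=> j; rewrite mulrC; apply: cvgMr; rewrite /jacobi_coef.
    have H1 : (fun n => qpoch Q Q (2 * n)%N) @ \oo --> qpoch_inf Q Q.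
      by apply: cvg_double; exact: qpoch_cvg.
    exact: (cvgMVV L0 H1 (cvg_inv_qfact (- j)) (cvg_inv_qfact j)).
  - exact: finite_jacobi.
  - exact: has_sumZ.
suff -> : theta z Q = t by [].
have -> : theta z Q = qpoch_inf Q Q * ((qpoch_inf Q Q)^-1 * t).
  rewrite /theta mulrC; congr (_ * _).
  exact: (cvg_unique _ (cvgM (qpoch_cvg (a := z) Q1) (qpoch_cvg (a := Q / z) Q1)) Hlim).
by rewrite mulVKf.
Qed.

Lemma theta_neq0 : (forall n : int, z != Q ^ n) -> theta z Q != 0.
Proof.
move=> Hz; rewrite /theta !mulf_neq0 ?qpoch_infQ_neq0 //.
- apply: qpoch_inf_neq0 => // k; rewrite subr_eq0 eq_sym; apply/eqP => h.
  move: (Hz (- k%:Z)); rewrite -invr_expz -exprnP => /eqP; apply.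
  by apply: (mulIf (expf_neq0 k Q0)); rewrite h mulVf // expf_neq0.
- apply: qpoch_inf_neq0 => // k; rewrite subr_eq0 eq_sym; apply/eqP => h.
  move: (Hz k.+1); rewrite -exprnP exprS => /eqP; apply.
  by rewrite -[LHS]mulr1 -h; field.
Qed.

End JTP.

(** * Hecke sums at integral powers *)

Section Hecke.
Variables (R : realType) (q : R[i]).
Hypotheses (q0 : q != 0) (q1 : `|q| < 1).

Lemma sg2E (r s : int) : sg2 R[i] r s =
  if (0 <= r) && (0 <= s) then 1 else if (r < 0) && (s < 0) then -1 else 0.
Proof.
rewrite /sg2 /sg; case: (lerP 0 r) => hr; case: (lerP 0 s) => hs /=.
- by field.
- by rewrite addrN mul0r.
- by rewrite addNr mul0r.
- by field.
Qed.

(** This line, with s unrestricted, carries a full theta series as the boundary term of a shift. *)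
Lemma sg2D1 (r s : int) : sg2 R[i] (r + 1) s - sg2 R[i] r s = (r == -1)%:R.
Proof.
rewrite /sg2 /sg -mulrBl opprD addrACA subrr addr0.
have [->|r1] := eqVneq r (-1); first by rewrite /=; field.
have -> : (0 <= r + 1) = (0 <= r) by lia.
by rewrite subrr mul0r.
Qed.

Lemma sg2C (r s : int) : sg2 R[i] r s = sg2 R[i] s r.
Proof. by rewrite /sg2 addrC. Qed.

Lemma exprqD (m n : int) : q ^ (m + n) = q ^ m * q ^ n.
Proof. exact: expfzDr. Qed.

Lemma expN1zD (m n : int) : (-1) ^ (m + n) = (-1) ^ m * (-1) ^ n :> R[i].
Proof. by rewrite expfzDr // N1neq0. Qed.

Lemma exprz_sqr (e : int) : (q ^+ 2) ^ e = q ^ (2 * e).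
Proof. by rewrite exprnP exprz_exp. Qed.

Let q20 : q ^+ 2 != 0. Proof. exact: expf_neq0. Qed.
Let q21 : `|q ^+ 2| < 1. Proof. by rewrite normrX exprn_ilt1. Qed.

Lemma theta_termE (b j : int) : theta_term (q ^+ 2) (q ^ (2 * b)) j =
  (-1) ^ j * q ^ (j * (j - 1) + 2 * b * j).
Proof.
rewrite /theta_term exprz_sqr exprz_exp -mulrA -expfzDr //.
by rewrite binom2_double.
Qed.

Lemma abs_summable_intpow (b : int) :
  abs_summable (fun j : int => (-1) ^ j * q ^ (j * (j - 1) + 2 * b * j)).
Proof.
have z0 : q ^ (2 * b) != 0 by exact: expfz_neq0.
have := abs_summable_theta_term q20 q21 z0.
by apply: abs_summable_le => j; rewrite theta_termE.
Qed.

(* The involution [j -> 1 - 2 b - j] pairs each term with its opposite. *)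
Lemma theta_intpow (b : int) :
  has_sum (fun j : int => (-1) ^ j * q ^ (j * (j - 1) + 2 * b * j)) 0.
Proof.
have z0 : q ^ (2 * b) != 0 by exact: expfz_neq0.
have [l Hl] := abs_summable_has_sum (abs_summable_theta_term q20 q21 z0).
have {}Hl := eq_has_sum (theta_termE b) Hl.
have inv : cancel (fun j : int => 1 - 2 * b - j) (fun j : int => 1 - 2 * b - j).
  by move=> j; ring.
have H := has_sumN (has_sum_bij inv inv Hl).
suff El : l = - l.
  suff -> : 0 = l by [].
  by have := mulrn_eq0 l 2; rewrite mulr2n {1}El addNr eqxx /= => /esym/eqP.
apply: has_sum_unique Hl _; apply: eq_has_sum H => j /=.
rewrite -mulNr; congr (_ * q ^ _); last by ring.
rewrite (_ : 1 - 2 * b - j = 1 + 2 * (- b - j) + j); last by ring.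
rewrite !expN1zD -exprz_exp expr1z mulN1r.
by rewrite (_ : (-1) ^ 2 = 1) ?exp1rz ?mulr1 ?mul1r ?mulN1r ?opprK // -exprnP sqrrN expr1n.
Qed.

Lemma expN1zN (n : int) : (-1) ^ (- n) = (-1) ^ n :> R[i].
Proof. by rewrite -exprz_inv invrN1. Qed.

(** * Quasi-periodicity of f_{1,2t,1} at integral powers *)

Section Shift.
Variables (t : int).
Hypothesis t1 : 1 <= t.

(* The monomials of f_{1,2t,1}(q^(2a), q^(2b); q^2), with the exponent of [q]
   written as a polynomial. *)
Definition hecke_mon (a b : int) (p : int * int) : R[i] :=
  (-1) ^ (p.1 + p.2)
  * q ^ (p.1 * (p.1 - 1) + 4 * t * p.1 * p.2 + p.2 * (p.2 - 1) + 2 * a * p.1 + 2 * b * p.2).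

Definition hecke_term (a b : int) (p : int * int) : R[i] := sg2 R[i] p.1 p.2 * hecke_mon a b p.

Lemma hecke_termE a b r s : hecke_term a b (r, s) = sg2 R[i] r s * hecke_mon a b (r, s).
Proof. by []. Qed.

Lemma hecke_monE a b r s : hecke_mon a b (r, s) = (-1) ^ (r + s)
  * q ^ (r * (r - 1) + 4 * t * r * s + s * (s - 1) + 2 * a * r + 2 * b * s).
Proof. by []. Qed.

Definition hecke_sum (a b : int) : R[i] := usum (hecke_term a b).

Lemma hecke_f_monomial (u v : R[i]) (a b r s : int) :
  u * v * (q ^ (2 * a)) ^ r * (q ^ (2 * b)) ^ s
  * (q ^+ 2) ^ (1 * binom2 r + 2 * t * r * s + 1 * binom2 s) =
  u * (v * q ^ (r * (r - 1) + 4 * t * r * s + s * (s - 1) + 2 * a * r + 2 * b * s)).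
Proof.
rewrite exprz_sqr (exprz_exp q (2 * a)) (exprz_exp q (2 * b)).
rewrite -!mulrA -!exprqD; congr (_ * (_ * q ^ _)).
have := binom2_double r; have := binom2_double s; lia.
Qed.

Lemma hecke_f_sum (a b : int) :
  hecke_f 1 (2 * t) 1 (q ^ (2 * a)) (q ^ (2 * b)) (q ^+ 2) = hecke_sum a b.
Proof.
rewrite /hecke_f /sumZ2 /hecke_sum /usum; congr summability.sum; apply/funext => -[r s].
exact: hecke_f_monomial.
Qed.

Lemma norm_le_quadratic (a r : int) : `|r| <= r * (r - 1) + 2 * a * r + (`|a| + 1) ^+ 2.
Proof.
have := sqr_ge0 (`|r| - `|a| - 1); have := ler_norm r.
have : - (`|a| * `|r|) <= a * r by rewrite -normrM lerNnormlW.
have : r * r = `|r| * `|r| by rewrite -normrM ger0_norm // -expr2 sqr_ge0.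
rewrite !expr2; lia.
Qed.

Lemma abs_summable_hecke_term a b : abs_summable (hecke_term a b).
Proof.
apply: (abs_summable_expz_le q0 q1 (k := (`|a| + 1) ^+ 2 + (`|b| + 1) ^+ 2)
  (abs_summable_expz2 q0 q1)) => -[r s]; rewrite /hecke_term sg2E /=.
have Hrs (e : R[i]) : `|e| = 1 -> 0 <= r * s -> exists2 e0 : int,
    `|e * hecke_mon a b (r, s)| <= `|q| ^ e0 &
    `|r| + `|s| <= e0 + ((`|a| + 1) ^+ 2 + (`|b| + 1) ^+ 2).
  move=> e1 rs; eexists.
    by rewrite /hecke_mon !normrM e1 normN1z !mul1r normrXz.
  have := norm_le_quadratic a r; have := norm_le_quadratic b s; rewrite /=.
  have : 0 <= 4 * t * r * s by rewrite -mulrA mulr_ge0 //; lia.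
  lia.
case: ifP => [/andP[r0 s0]|_]; first by right; apply: Hrs; rewrite ?normr1 ?mulr_ge0.
case: ifP => [/andP[r0 s0]|_]; last by left; rewrite mul0r.
by right; apply: Hrs; rewrite ?normrN1 // nmulr_rge0 // ltW.
Qed.

Lemma has_sum_hecke_term a b : has_sum (hecke_term a b) (hecke_sum a b).
Proof.
have [l Hl] := abs_summable_has_sum (abs_summable_hecke_term a b).
by rewrite /hecke_sum (has_sumE Hl).
Qed.

Lemma hecke_sumC a b : hecke_sum a b = hecke_sum b a.
Proof.
apply: has_sumE; have := has_sum_swap (@has_sum_hecke_term b a).
apply: eq_has_sum => -[r s] /=.
rewrite /hecke_term /hecke_mon /= sg2C [s + r]addrC; congr (_ * (_ * q ^ _)); ring.
Qed.

Lemma hecke_mon_shift_r a b r s :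
  hecke_mon a b (r + 1, s) = - q ^ (2 * a) * hecke_mon (a + 1) (b + 2 * t) (r, s).
Proof.
rewrite !hecke_monE addrAC (expN1zD (r + s)) expr1z mulrN1 !mulNr mulrCA -exprqD.
by congr (- (_ * q ^ _)); ring.
Qed.

(* The boundary terms of the shift form a theta series at an integral power
   of [q ^+ 2], which vanishes. *)
Lemma hecke_sum_shift_r a b : hecke_sum a b = - q ^ (2 * a) * hecke_sum (a + 1) (b + 2 * t).
Proof.
have H1 := has_sum_bij (h := fun p : int * int => (p.1 + 1, p.2))
  (k := fun p : int * int => (p.1 - 1, p.2)) _ _ (@has_sum_hecke_term a b).
have {}H1 : has_sum (hecke_term a b \o (fun p : int * int => (p.1 + 1, p.2))) (hecke_sum a b).
  by apply: H1 => -[r s] /=; rewrite ?addrK ?subrK.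
have H2 := has_sumZ (c := - q ^ (2 * a)) (@has_sum_hecke_term (a + 1) (b + 2 * t)).
have H3 := has_sum_swap (has_sum_line (-1 : int) (abs_summable_intpow b) (@theta_intpow b)).
apply/eqP; rewrite -subr_eq0; apply/eqP.
apply: has_sum_unique (has_sumB H1 H2) _.
apply: eq_has_sum H3 => -[r s] /=; rewrite /hecke_term /=.
rewrite [- q ^ (2 * a) * _]mulrCA -hecke_mon_shift_r -mulrBl sg2D1 mulrC.
have [->|//] := eqVneq r (-1); last by rewrite !mul0r.
rewrite addNr /hecke_mon /= !mul1r; congr (_ ^ _ * q ^ _); ring.
Qed.

Lemma hecke_sum_shift_s a b : hecke_sum a b = - q ^ (2 * b) * hecke_sum (a + 2 * t) (b + 1).
Proof. by rewrite hecke_sumC hecke_sum_shift_r hecke_sumC. Qed.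

Lemma hecke_sum_shift_sn a b (n : nat) :
  hecke_sum a b = (-1) ^+ n * q ^ (2 * n%:Z * b + n%:Z * (n%:Z - 1))
             * hecke_sum (a + 2 * t * n%:Z) (b + n%:Z).
Proof.
elim: n => [|n IH]; first by rewrite !mulr0 !mul0r !addr0 expr0z !mul1r.
rewrite IH hecke_sum_shift_s exprSr.
have -> : a + 2 * t * n%:Z + 2 * t = a + 2 * t * n.+1%:Z by rewrite intS; ring.
have -> : b + n%:Z + 1 = b + n.+1%:Z by rewrite intS; ring.
have -> : 2 * n.+1%:Z * b + n.+1%:Z * (n.+1%:Z - 1) =
    2 * n%:Z * b + n%:Z * (n%:Z - 1) + 2 * (b + n%:Z) by rewrite intS; ring.
by rewrite [in RHS]exprqD; ring.
Qed.

(** Both 2 t shifts in s from (a, b) and one shift in r from (a + 4 t^2 - 1, b) lead to (a + 4 t^2,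
    b + 2 t). The even number of shifts contributes no sign, so one minus sign remains. *)
Lemma hecke_sum_shift_discr a b : hecke_sum a b =
  - q ^ (4 * t * b + 4 * t ^+ 2 - 2 * t - 2 * a - 2 * (4 * t ^+ 2 - 1))
  * hecke_sum (a + (4 * t ^+ 2 - 1)) b.
Proof.
have [n tn] : exists n : nat, 2 * t = n%:Z by exists (absz (2 * t)); lia.
rewrite (hecke_sum_shift_sn a b n) (hecke_sum_shift_r (a + (4 * t ^+ 2 - 1))) -tn.
have -> : (-1) ^+ n = 1 :> R[i].
  have -> : n = (2 * absz t)%N by lia.
  by rewrite exprM sqrrN !expr1n.
rewrite mul1r !mulNr mulrN opprK [in RHS]mulrA -[in RHS]exprqD.
congr (q ^ _ * hecke_sum _ _); ring.
Qed.

Lemma hecke_sum_shift_discrz a b (S : int) : hecke_sum (a + (4 * t ^+ 2 - 1) * S) b =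
  (-1) ^ S * q ^ (2 * a * S + (4 * t ^+ 2 - 1) * (S * (S - 1))
                  + (4 * t ^+ 2 - 2 + 2 * t - 4 * t * b) * S) * hecke_sum a b.
Proof.
pose e S := 2 * a * S + (4 * t ^+ 2 - 1) * (S * (S - 1))
  + (4 * t ^+ 2 - 2 + 2 * t - 4 * t * b) * S.
rewrite -/(e S).
(* Normalised by the expected factor, the values should be constant; invariance under T -> T + 1
   settles both signs of S. *)
pose u S := (-1) ^ S * q ^ (- e S) * hecke_sum (a + (4 * t ^+ 2 - 1) * S) b.
have uS T : u (T + 1) = u T.
  rewrite /u (hecke_sum_shift_discr (a + _ * T)) expN1zD expr1z.
  have -> : a + (4 * t ^+ 2 - 1) * T + (4 * t ^+ 2 - 1)
    = a + (4 * t ^+ 2 - 1) * (T + 1) by ring.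
  rewrite mulrN1 !mulNr !mulrN; congr (- _); rewrite [in RHS]mulrA.
  congr (_ * hecke_sum _ _); rewrite -[RHS]mulrA -exprqD.
  by congr (_ * q ^ _); rewrite /e; ring.
have u0 T : u T = u 0.
  elim/int_ind: T => [//|n <-|n <-]; first by rewrite intS addrC uS.
  by rewrite -(uS (- n.+1%:Z)); congr u; lia.
have u00 : u 0 = hecke_sum a b.
  rewrite /u (_ : - e 0 = 0); last by rewrite /e; ring.
  by rewrite mulr0 addr0 !expr0z !mul1r.
rewrite -u00 -(u0 S) /u.
rewrite mulrA mulrACA -exprqD -expN1zD subrr expr0z mulr1.
rewrite (_ : S + S = 2 * S); last by ring.
by rewrite -exprz_exp -exprnP sqrrN expr1n exp1rz mul1r.
Qed.

End Shift.

(* [theta y (q ^+ 2) / (1 - y q^(2r))] as a double sum over the two cones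
   [M, n >= 0] and [M, n < 0]: unlike the geometric series, it converges
   absolutely for every [y <> 0]. *)
Definition quot_mon (y : R[i]) (r : int) (p : int * int) : R[i] :=
  (-1) ^ (p.1 + p.2)
  * q ^ ((p.1 + p.2 + 1) * (p.1 + p.2) + 2 * r * p.2) * y ^ (- p.1).

Definition quot_term (y : R[i]) (r : int) (p : int * int) : R[i] :=
  sg2 R[i] p.1 p.2 * quot_mon y r p.

Lemma norm_quot_mon_le (y : R[i]) (c r M n : int) :
  `|y ^ (- M)| <= `|q| ^ (- c * `|M|) ->
  `|quot_mon y r (M, n)| <= `|q| ^ ((M + n + 1) * (M + n) + 2 * r * n - c * `|M|).
Proof.
move=> h; rewrite /quot_mon /= !normrM normN1z mul1r normrXz -mulNr.
rewrite [leRHS]expfzDr ?normr_eq0 //; apply: ler_wpM2l => //.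
by rewrite exprz_ge0.
Qed.

(** The form (M + n)^2 is degenerate, but |M + n| = |M| + |n| on the cones, so it dominates the
    linear terms due to r and y. *)
Lemma abs_summable_quot_term y r : y != 0 -> abs_summable (quot_term y r).
Proof.
move=> y0; have [c c0 Hc] := norm_expz_growth q0 q1 y0.
apply: (abs_summable_expz_le q0 q1 (k := (2 * `|r| + c + 2) ^+ 2)
  (abs_summable_expz2 q0 q1)) => -[M n]; rewrite /quot_term sg2E /=.
have H (e : R[i]) : `|e| = 1 -> `|M + n| = `|M| + `|n| -> exists2 e0 : int,
    `|e * quot_mon y r (M, n)| <= `|q| ^ e0 & `|M| + `|n| <= e0 + (2 * `|r| + c + 2) ^+ 2.
  move=> e1 Mn; eexists.
    rewrite normrM e1 mul1r; apply: (@norm_quot_mon_le _ c).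
    by have := Hc (- M); rewrite normrN.
  have h1 : - (`|r| * `|n|) <= r * n by rewrite -normrM lerNnormlW.
  have h2 : (M + n) * (M + n) = (`|M| + `|n|) * (`|M| + `|n|).
    by rewrite -Mn -normrM ger0_norm // -expr2 sqr_ge0.
  have h3 := sqr_ge0 (`|M| + `|n| - (2 * `|r| + c + 2)).
  have h4 : - (`|M| + `|n|) <= M + n by lia.
  have h5 : 0 <= `|r| * `|M| by rewrite mulr_ge0.
  have h6 : 0 <= `|r| * `|n| by rewrite mulr_ge0.
  have h7 : 0 <= c * `|n| by rewrite mulr_ge0.
  have h8 : 0 <= c * `|M| by rewrite mulr_ge0.
  have h9 : 0 <= c * `|r| by rewrite mulr_ge0.
  have Ew : (M + n + 1) * (M + n) = (M + n) * (M + n) + (M + n) by ring.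
  rewrite Ew h2 -[2 * r * n]mulrA; move: h1 h3 h4 h5 h6 h7 h8 h9 (c0); rewrite !expr2.
  have := normr_ge0 M; have := normr_ge0 n; have := normr_ge0 r.
  move: (`|M|) (`|n|) (`|r|) (M + n) (r * n) => A B rho w rn.
  clear; lia.
case: ifP => [/andP[M0 n0]|_]; first by right; apply: H; rewrite ?normr1 //; lia.
case: ifP => [/andP[M0 n0]|_]; last by left; rewrite mul0r.
by right; apply: H; rewrite ?normrN1 //; lia.
Qed.

(** The shift (M + 1, n - 1) fixes M + n and divides the monomial by y q^(2r). Multiplying the sum
    by 1 - y q^(2r) thus leaves only the lines n = 0, which is the series of theta, and M = -1, a
    vanishing theta series at an integral power. *)
Lemma quot_term_sum y r : y != 0 -> 1 - y * q ^ (2 * r) != 0 ->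
  has_sum (quot_term y r) (theta y (q ^+ 2) / (1 - y * q ^ (2 * r))).
Proof.
move=> y0 y1; have [l Hl] := abs_summable_has_sum (abs_summable_quot_term r y0).
suff E : (1 - y * q ^ (2 * r)) * l = theta y (q ^+ 2) by rewrite -E mulrC mulKf.
have H1 := has_sum_bij (h := fun p : int * int => (p.1 + 1, p.2 - 1))
  (k := fun p : int * int => (p.1 - 1, p.2 + 1)) _ _ Hl.
have {}H1 : has_sum (quot_term y r \o (fun p : int * int => (p.1 + 1, p.2 - 1))) l.
  by apply: H1 => -[M n] /=; rewrite ?addrK ?subrK.
have {}H1 := has_sumB Hl (has_sumZ (c := y * q ^ (2 * r)) H1).
have J := jacobi_triple_product q20 q21 y0.
have aJ := abs_summable_theta_term q20 q21 y0.
have oppK : cancel (@GRing.opp int) (@GRing.opp int) by exact: opprK.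
have L1 := has_sum_line (0 : int) (abs_summable_inj (can_inj oppK) aJ)
  (has_sum_bij oppK oppK J).
have L2 := has_sum_swap (has_sum_line (-1 : int)
  (abs_summableZ y (abs_summable_intpow r)) (has_sumZ (c := y) (@theta_intpow r))).
have L := has_sumD L1 L2; rewrite mulr0 addr0 in L.
rewrite mulrBl mul1r; apply: (has_sum_unique H1); move: L; apply: eq_has_sum => -[M n] /=.
rewrite /quot_term /=.
have -> : quot_mon y r (M + 1, n - 1) = quot_mon y r (M, n) / (y * q ^ (2 * r)).
  rewrite /quot_mon /=.
  have -> : M + 1 + (n - 1) = M + n by ring.
  have -> : (M + n + 1) * (M + n) + 2 * r * (n - 1) =
    (M + n + 1) * (M + n) + 2 * r * n - 2 * r by ring.
  rewrite opprD exprqD (expfzDr _ (- 1) y0) exprN1 -(invr_expz q).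
  by field; rewrite y0 expfz_neq0.
have -> : sg2 R[i] M n * quot_mon y r (M, n) - y * q ^ (2 * r) *
    (sg2 R[i] (M + 1) (n - 1) * (quot_mon y r (M, n) / (y * q ^ (2 * r)))) =
    (sg2 R[i] M n - sg2 R[i] (M + 1) (n - 1)) * quot_mon y r (M, n).
  by field; rewrite y0 expfz_neq0.
have -> : sg2 R[i] M n - sg2 R[i] (M + 1) (n - 1) = (n == 0)%:R - (M == -1)%:R.
  have := sg2D1 M n; have := sg2D1 (n - 1) (M + 1).
  rewrite !(sg2C (n - 1)) ![sg2 _ (n - 1 + 1) _]sg2C subrK => h1 h2.
  have -> : (n == 0) = (n - 1 == -1) by lia.
  by rewrite -h1 -h2; ring.
rewrite mulrBl; congr (_ + _).
  have [->|] := eqVneq n 0; last by rewrite mulr0 mul0r.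
  rewrite mulr1 mul1r /theta_term /quot_mon /= exprz_sqr !addr0 !mulr0 addr0 binom2_double.
  by rewrite expN1zN; congr (_ * q ^ _ * _); ring.
rewrite -mulNr; have [->|] := eqVneq M (-1); last by rewrite mulr0 oppr0 mul0r.
rewrite mulr1 mulN1r /quot_mon /= opprK expr1z expN1zD exprN1 invrN1 mulN1r.
rewrite !mulNr opprK mulrC; congr (_ * q ^ _ * _); ring.
Qed.

End Hecke.

(** * The quadruple sum *)

(** If 2 r >= c, then 2 r M absorbs c M; otherwise r is bounded, M <= u + r makes c M at most linear
    in u, and u^2 absorbs it. *)
Lemma cone_quadratic_bound (b c r M u : int) : 0 <= b -> 0 <= c -> 0 <= r -> 0 <= M ->
  M <= u + r -> - (b + c) ^+ 2 - c ^+ 2 - b ^+ 2 <= u * u - b * u + 2 * r * M - c * M.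
Proof.
move=> b0 c0 r0 M0 Mu; rewrite !expr2.
have hb := sqr_ge0 (u - b); have hbc := sqr_ge0 (u - (b + c)).
have hu := sqr_ge0 u; rewrite !expr2 in hb hbc hu.
have [rc|rc] := lerP c (2 * r).
  have : 0 <= (2 * r - c) * M by rewrite mulr_ge0 // subr_ge0.
  have : 0 <= c * c by rewrite mulr_ge0.
  nia.
have : c * M <= c * (u + r) by rewrite ler_wpM2l.
have : c * r <= c * c by rewrite ler_wpM2l //; lia.
have : 0 <= 2 * r * M by rewrite !mulr_ge0.
have : 0 <= b * b by rewrite mulr_ge0.
nia.
Qed.

(** The lower bound on a = t + m serves the cone r, s >= 0, the upper one the cone r, s < 0. When
    (M, n) has the opposite sign, [cone_quadratic_bound] is applied with u = |M| + |n| - |r|. *)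
Lemma quadruple_exponent_bound (t m c r s M n : int) :
  1 <= t -> 1 - t <= m <= t -> 0 <= c ->
  (0 <= r) && (0 <= s) || (r < 0) && (s < 0) ->
  (0 <= M) && (0 <= n) || (M < 0) && (n < 0) ->
  `|r| + `|s| + `|M| + `|n| <=
  r * (r - 1) + 4 * t * r * s + s * (s - 1) + 2 * (t + m) * r + 2 * (t + m) * s
  + ((M + n + 1) * (M + n) + 2 * r * n - c * `|M|)
  + (4 * t ^+ 2 + 4 * t + 4 * (c + 3) ^+ 2).
Proof.
move=> t1 /andP[m1 m2] c0; rewrite !expr2.
set a := t + m; have a1 : 1 <= a by rewrite /a; lia.
have a2 : a <= 2 * t by rewrite /a; lia.
move: a a1 a2 => a a1 a2.
case/orP=> /andP[r0 s0] /orP[] /andP[M0 n0].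
- rewrite !ger0_norm //.
  have := sqr_ge0 (M + n - c); rewrite expr2.
  have : 0 <= 4 * t * r * s by rewrite !mulr_ge0 //; lia.
  have : 0 <= r * n by rewrite mulr_ge0.
  have : 0 <= c * n by rewrite mulr_ge0.
  have : 0 <= c * M by rewrite mulr_ge0.
  have : 0 <= (a - 1) * r by rewrite mulr_ge0 // subr_ge0.
  have : 0 <= (a - 1) * s by rewrite mulr_ge0 // subr_ge0.
  have : 0 <= r * (r - 0) by rewrite subr0 mulr_ge0.
  have : 0 <= s * (s - 0) by rewrite subr0 mulr_ge0.
  have : 0 <= t * t by rewrite mulr_ge0 //; lia.
  have : 0 <= c * c by rewrite mulr_ge0.
  lia.
- rewrite (ger0_norm r0) (ger0_norm s0) !ltr0_norm //.
  have [mu EM] : exists mu, M = - mu by exists (- M); rewrite opprK.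
  have [nu En] : exists nu, n = - nu by exists (- n); rewrite opprK.
  rewrite {}EM {}En !opprK in M0 n0 *.
  (* Subtracting the norms leaves u^2 - 2 u + 2 r (mu - 1) + 2 (a - 1) r - c mu plus nonnegative
     terms in s: hence b = 2 and the argument mu - 1, nonnegative because M < 0 strictly. *)
  have : - (2 + c) ^+ 2 - c ^+ 2 - 2 ^+ 2 <= (mu + nu - r) * (mu + nu - r)
      - 2 * (mu + nu - r) + 2 * r * (mu - 1) - c * (mu - 1).
    by apply: cone_quadratic_bound => //; lia.
  rewrite !expr2.
  have : 0 <= 4 * t * r * s by rewrite !mulr_ge0 //; lia.
  have : 0 <= (a - 1) * r by rewrite mulr_ge0 // subr_ge0.
  have : 0 <= (a - 1) * s by rewrite mulr_ge0 // subr_ge0.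
  have : 0 <= s * s by rewrite mulr_ge0.
  have : 0 <= t * t by rewrite mulr_ge0 //; lia.
  have : 0 <= c * c by rewrite mulr_ge0.
  lia.
- rewrite (ger0_norm M0) (ger0_norm n0) !ltr0_norm //.
  have [rho Er] : exists rho, r = - rho by exists (- r); rewrite opprK.
  have [sg Es] : exists sg, s = - sg by exists (- s); rewrite opprK.
  rewrite {}Er {}Es !opprK in r0 s0 *.
  (* Here the linear terms in M + n cancel, so b = 0. Since sg >= 1 and a <= 2 t, the cross term 4 t
     rho sg absorbs 2 a rho; completing the square in sg costs a^2 <= 4 t^2. *)
  have : - (0 + c) ^+ 2 - c ^+ 2 - 0 ^+ 2 <= (M + n - rho) * (M + n - rho)
      - 0 * (M + n - rho) + 2 * rho * M - c * M.
    by apply: cone_quadratic_bound => //; lia.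
  rewrite !expr2.
  have : 0 <= t * rho * (sg - 1) by rewrite !mulr_ge0 //; lia.
  have : 0 <= (2 * t - a) * rho by rewrite !mulr_ge0 //; lia.
  have := sqr_ge0 (sg - a); rewrite expr2.
  have : a * a <= (2 * t) * (2 * t) by apply: ler_pM => //; lia.
  have : 0 <= c * c by rewrite mulr_ge0.
  lia.
- rewrite !ltr0_norm //.
  have [rho Er] : exists rho, r = - rho by exists (- r); rewrite opprK.
  have [sg Es] : exists sg, s = - sg by exists (- s); rewrite opprK.
  have [mu EM] : exists mu, M = - mu by exists (- M); rewrite opprK.
  have [nu En] : exists nu, n = - nu by exists (- n); rewrite opprK.
  rewrite {}Er {}Es {}EM {}En !opprK in r0 s0 M0 n0 *.
  have := sqr_ge0 (mu + nu - (c + 2)); rewrite expr2.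
  have : 0 <= t * ((rho - 1) * (sg - 1)) by rewrite !mulr_ge0 //; lia.
  have : 0 <= (2 * t - a) * rho by rewrite !mulr_ge0 //; lia.
  have : 0 <= (2 * t - a) * sg by rewrite !mulr_ge0 //; lia.
  have : 0 <= rho * rho by rewrite mulr_ge0 //; lia.
  have : 0 <= sg * sg by rewrite mulr_ge0 //; lia.
  have : 0 <= rho * nu by rewrite mulr_ge0 //; lia.
  have : 0 <= c * mu by rewrite mulr_ge0 //; lia.
  have : 0 <= c * nu by rewrite mulr_ge0 //; lia.
  have : 0 <= t * t by rewrite mulr_ge0 //; lia.
  have : 0 <= c * c by rewrite mulr_ge0.
  lia.
Qed.

(** * The quadruple sum evaluated in both orders *)

Section Main.
Variables (R : realType) (q : R[i]).
Hypotheses (q0 : q != 0) (q1 : `|q| < 1).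
Variables (t m : int).
Hypotheses (t1 : 1 <= t) (hm : 1 - t <= m <= t).
Variable (y : R[i]).
Hypothesis (y0 : y != 0).

Definition quadruple_term (p : (int * int) * (int * int)) : R[i] :=
  hecke_term q t (t + m) (t + m) p.1 * quot_term q y p.1.1 p.2.

Lemma quadruple_termE r s M n : quadruple_term ((r, s), (M, n)) =
  sg2 R[i] r s * hecke_mon q t (t + m) (t + m) (r, s) * (sg2 R[i] M n * quot_mon q y r (M, n)).
Proof. by []. Qed.

Lemma abs_summable_quadruple_term : abs_summable quadruple_term.
Proof.
have [c c0 Hc] := norm_expz_growth q0 q1 y0.
apply: (abs_summable_expz_le q0 q1 (k := 4 * t ^+ 2 + 4 * t + 4 * (c + 3) ^+ 2)
  (abs_summable_expz4 q0 q1)) => -[[r s] [M n]].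
rewrite quadruple_termE.
have sgP (u v : int) : sg2 R[i] u v = 0 \/
    `|sg2 R[i] u v| = 1 /\ ((0 <= u) && (0 <= v) || (u < 0) && (v < 0)).
  rewrite sg2E; case: ifP => [_|_]; first by right; rewrite normr1.
  by case: ifP => [_|_]; [right; rewrite normrN1|left].
have [E|[E1 H1]] := sgP r s; first by left; rewrite E !mul0r.
have [E|[E2 H2]] := sgP M n; first by left; rewrite E mul0r mulr0.
right; eexists; last exact: (quadruple_exponent_bound t1 hm c0 H1 H2).
rewrite expfzDr ?normr_eq0 //.
rewrite (normrM (sg2 R[i] r s * _)) (normrM (sg2 R[i] r s)) (normrM (sg2 R[i] M n)).
rewrite E1 E2 !mul1r; apply: ler_pM => //.
  by rewrite hecke_monE normrM normN1z mul1r normrXz.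
by apply: norm_quot_mon_le => //; have := Hc (- M); rewrite normrN.
Qed.


Let D : int := 4 * t ^+ 2 - 1.

(* Summing over [(M, n)] first produces the theta function over [1 - y q^(2r)]. *)
Lemma quadruple_sum_quadrant (P : int -> int -> bool) (e : R[i]) S :
  (forall r : int, 1 - y * q ^ (2 * r) != 0) ->
  (forall r s, P r s -> sg2 R[i] r s = e) ->
  has_sum (fun p => if P p.1.1 p.1.2 then quadruple_term p else 0) S ->
  S = e * theta y (q ^+ 2) * usum (fun rs : int * int => if P rs.1 rs.2 then
        hecke_mon q t (t + m) (t + m) rs / (1 - y * q ^ (2 * rs.1)) else 0).
Proof.
move=> y1 Pe HS; apply: usum_of_has_sumZ.
apply: has_sum_fubini HS _ => -[r s] /=.
case: ifP => Prs; last first.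
  rewrite mulr0; have := has_sum_fset (f := fun=> 0 : R[i]) (A := fset0 : {fset int * int}).
  by rewrite big_seq_fset0; apply.
have H := has_sumZ (c := hecke_term q t (t + m) (t + m) (r, s))
  (@quot_term_sum _ _ q0 q1 y r y0 (y1 r)).
have E : hecke_term q t (t + m) (t + m) (r, s) * (theta y (q ^+ 2) / (1 - y * q ^ (2 * r))) =
    e * theta y (q ^+ 2) * (hecke_mon q t (t + m) (t + m) (r, s) / (1 - y * q ^ (2 * r))).
  rewrite hecke_termE (Pe _ _ Prs).
  move: (hecke_mon _ _ _ _ _) (theta _ _) (_^-1) => u v w; ring.
rewrite E in H; exact: H.
Qed.

(** [p_sum] is a difference of two unordered sums, so the cones of (r, s) are treated separately. As
    y avoids the even powers of q, theta can be divided out. *)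
Lemma p_sum_eq (S : R[i]) : (forall n : int, y != q ^ (2 * n)) ->
  has_sum quadruple_term S -> p_sum t m y (q ^+ 2) = S / theta y (q ^+ 2).
Proof.
move=> hy HS.
have th0 : theta y (q ^+ 2) != 0.
  apply: theta_neq0; rewrite ?expf_neq0 // ?normrX ?exprn_ilt1 // => n.
  by rewrite exprz_sqr.
have y1 r : 1 - y * q ^ (2 * r) != 0.
  rewrite subr_eq0 eq_sym; apply/eqP => h; move: (hy (- r)) => /eqP; apply.
  rewrite mulrN -invr_expz; apply: (mulIf (expfz_neq0 (2 * r) q0)).
  by rewrite h mulVf // expfz_neq0.
have sumP (P : int -> int -> bool) : exists SP,
    has_sum (fun p => if P p.1.1 p.1.2 then quadruple_term p else 0) SP.
  apply: abs_summable_has_sum; apply: abs_summable_le abs_summable_quadruple_term => p.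
  by case: ifP => // _; rewrite normr0.
have [S1 H1] := sumP (fun r s => (0 <= r) && (0 <= s)).
have [S2 H2] := sumP (fun r s => (r < 0) && (s < 0)).
have ES : S = S1 + S2.
  apply: has_sum_unique HS _; apply: eq_has_sum (has_sumD H1 H2) => -[[r s] [M n]].
  rewrite /= !quadruple_termE !(sg2E R r s).
  case: ifP => [/andP[r0 s0]|_]; first by rewrite ltNge r0 s0 /= addr0.
  by case: ifP => rs; rewrite add0r ?rs // !mul0r.
have E1 := @quadruple_sum_quadrant (fun r s => (0 <= r) && (0 <= s)) 1 S1 y1 _ H1.
have E2 := @quadruple_sum_quadrant (fun r s => (r < 0) && (s < 0)) (-1) S2 y1 _ H2.
rewrite ES E1 ?E2; first last.
- by move=> r s rs; rewrite sg2E rs.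
- by move=> r s rs; rewrite sg2E rs; case: ifP rs => // /andP[? ?] /andP[? ?]; lia.
rewrite mulN1r mulNr mul1r -mulrBr mulrAC mulfV // mul1r /p_sum.
have pE (P : int -> int -> bool) : sumZ2_on P (p_term t m y (q ^+ 2)) =
    usum (fun rs : int * int => if P rs.1 rs.2 then
      hecke_mon q t (t + m) (t + m) rs / (1 - y * q ^ (2 * rs.1)) else 0).
  rewrite /sumZ2_on /sumZ2 /usum; congr summability.sum; apply/funext => -[r s].
  rewrite /=.
  case: ifP => // _; rewrite /p_term hecke_monE !exprz_sqr; congr (_ * q ^ _ / _).
  have := binom2_double r; have := binom2_double s; lia.
by rewrite !pE.
Qed.

Lemma quot_monE r M n : quot_mon q y r (M, n) =
  (-1) ^ (M + n) * q ^ ((M + n + 1) * (M + n) + 2 * r * n) * y ^ (- M).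
Proof. by []. Qed.

Lemma quot_termE r M n : quot_term q y r (M, n) = sg2 R[i] M n * quot_mon q y r (M, n).
Proof. by []. Qed.

(** The pairs (r, s) and (M, n) interact only through q^(2 r n), which moves the first Hecke
    parameter by n. *)
Lemma quadruple_term_hecke r s M n : quadruple_term ((r, s), (M, n)) =
  quot_term q y 0 (M, n) * hecke_term q t (t + m + n) (t + m) (r, s).
Proof.
have regroup (a b c d z A B A' B' : R[i]) : A * B = A' * B' ->
    a * (b * A) * (c * (d * B * z)) = c * (d * B' * z) * (a * (b * A')).
  by move=> E; transitivity (a * b * c * d * z * (A * B)); [ring|rewrite E; ring].
by apply: regroup; rewrite /= -!(exprqD q0); congr (q ^ _); ring.
Qed.

(** The exponent is that of [quot_mon] at M = 0, n = k, r = 0, namely k^2 + k, plus that of one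
    quasi-period from the base point t + m - D + k. *)
Definition outer_coef (k : int) : R[i] :=
  (-1) ^ k * q ^ (k * k + 3 * k - 2 * (2 * t - 1) * (2 * t + m))
  * hecke_sum q t (t + m - D + k) (t + m).

Definition outer_term (k M S : int) : R[i] :=
  sg2 R[i] M S * ((-1) ^ M * y ^ (- M) * q ^ (M * (M - 1) + 2 * D * M * S
    + 4 * t ^+ 2 * D * (S * (S - 1)) + (2 * k + 2) * M
    + (16 * t ^+ 4 - 4 * t ^+ 2 - 2 * (m - 1) * (2 * t - 1) + 8 * t ^+ 2 * k) * S)).

(* Summing over [(r, s)] first produces Hecke sums that are quasi-periodic in
   [n = k + D S], so that only their values at the residues [k] remain. *)
Lemma quadruple_inner_sum k M S : 0 <= k < D ->
  has_sum (fun rs => quadruple_term (rs, (M, k + D * S))) (- outer_coef k * outer_term k M S).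
Proof.
move=> /andP[k0 kD].
have H := has_sumZ (c := quot_term q y 0 (M, k + D * S))
  (@has_sum_hecke_term _ _ q0 q1 t t1 (t + m + (k + D * S)) (t + m)).
suff E : quot_term q y 0 (M, k + D * S) * hecke_sum q t (t + m + (k + D * S)) (t + m) =
    - outer_coef k * outer_term k M S.
  by rewrite -E; apply: eq_has_sum H => -[r s]; rewrite quadruple_term_hecke.
(* The base point lies one period lower, as in the first argument of f_{1,2t,1} in the theorem;
   hence S + 1 and an extra sign. *)
have -> : t + m + (k + D * S) = t + m - D + k + D * (S + 1) by ring.
rewrite (hecke_sum_shift_discrz q0 q1 t1) quot_termE quot_monE /outer_coef /outer_term.
(* Because 0 <= k < D, n and S are nonnegative together, so cones in (M, n) become cones in (M,
   S). *)
have -> : sg2 R[i] M (k + D * S) = sg2 R[i] M S.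
  rewrite /sg2 /sg; have -> // : (0 <= k + D * S) = (0 <= S).
  by apply/idP/idP => h; rewrite /D in k0 kD h *; nia.
have -> : (-1) ^ (M + (k + D * S)) = (-1) ^ M * (-1) ^ k * (-1) ^ S :> R[i].
  (* D is odd, so (-1)^(D S) = (-1)^S, which cancels the sign of the quasi-period up to one factor
     -1. *)
  have -> : M + (k + D * S) = 2 * (2 * t ^+ 2 * S - S) + (M + k + S) by rewrite /D; ring.
  rewrite !expN1zD -exprz_exp (_ : (-1) ^ 2 = 1) ?exp1rz ?mul1r //.
  by rewrite -exprnP sqrrN expr1n.
rewrite (expN1zD R S 1) expr1z mulrN1.
have SS : (-1) ^ S * (-1) ^ S = 1 :> R[i].
  rewrite -expN1zD (_ : S + S = 2 * S); last by ring.
  by rewrite -exprz_exp -exprnP sqrrN expr1n exp1rz.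
have regroup (u a b c z A B h A' B' : R[i]) : c * c = 1 -> A * B = A' * B' ->
    u * (a * b * c * A * z) * (- c * B * h) = - (b * A' * h) * (u * (a * z * B')).
  move=> E1 E2; transitivity (- (u * a * b * z * h * (c * c) * (A * B))); first by ring.
  by rewrite E1 E2; ring.
apply: regroup => //; rewrite -!(exprqD q0); congr (q ^ _).
by rewrite /D; ring.
Qed.

(** The minus sign in the second argument of the Hecke sum cancels the (-1)^S of its definition, in
    accordance with [outer_term]. *)
Lemma outer_monomial (x u : R[i]) (e k M S : int) : y = x * q ->
  u * (-1) ^ (M + S) * (x^-1 * q ^ (2 * k + 1)) ^ M * (- q ^ e) ^ S
  * (q ^+ 2) ^ (1 * binom2 M + D * M * S + 4 * t ^+ 2 * D * binom2 S) =
  u * ((-1) ^ M * y ^ (- M) * q ^ (M * (M - 1) + 2 * D * M * S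
    + 4 * t ^+ 2 * D * (S * (S - 1)) + (2 * k + 2) * M + e * S)).
Proof.
move=> yx; have x0 : x != 0 by move: y0; rewrite yx mulf_eq0 negb_or => /andP[].
have -> : x^-1 * q ^ (2 * k + 1) = y^-1 * q ^ (2 * k + 2).
  have -> : 2 * k + 2 = 2 * k + 1 + 1 by ring.
  rewrite yx (exprqD q0 (2 * k + 1) 1) expr1z; move: (q ^ (2 * k + 1)) => A.
  by field; rewrite x0 q0.
rewrite exprz_sqr -[- q ^ e]mulN1r !expfzMl exprz_inv expN1zD.
rewrite (exprz_exp q (2 * k + 2)) (exprz_exp q e).
have SS : (-1) ^ S * (-1) ^ S = 1 :> R[i].
  rewrite -expN1zD (_ : S + S = 2 * S); last by ring.
  by rewrite -exprz_exp -exprnP sqrrN expr1n exp1rz.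
have regroup (a c z A1 A2 A3 : R[i]) : c * c = 1 ->
    u * (a * c) * (z * A1) * (c * A2) * A3 = u * (a * z * (A1 * A2 * A3)).
  move=> E; transitivity (u * a * z * (c * c) * A1 * A2 * A3); first by ring.
  by rewrite E; ring.
rewrite regroup // -!(exprqD q0); congr (_ * (_ * q ^ _)).
have := binom2_double M; have := binom2_double S => HS HM.
have -> : M * (M - 1) = 2 * binom2 M by rewrite HM.
have -> : S * (S - 1) = 2 * binom2 S by rewrite HS.
by ring.
Qed.

Lemma hecke_outer (x : R[i]) k : y = x * q ->
  hecke_f 1 D (4 * t ^+ 2 * D) (x^-1 * q ^ (2 * k + 1))
    (- q ^ (16 * t ^+ 4 - 4 * t ^+ 2 - 2 * (m - 1) * (2 * t - 1) + 8 * t ^+ 2 * k)) (q ^+ 2)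
  = usum (fun p : int * int => outer_term k p.1 p.2).
Proof.
move=> yx; rewrite /hecke_f /sumZ2 /usum; congr summability.sum; apply/funext => -[M S].
exact: outer_monomial.
Qed.

(** Euclidean division of n by D reindexes the sum by (k, (M, S), (r, s)). Fubini is applied over k,
    then over (M, S); each subfamily inherits absolute summability along an injection. *)
Lemma quadruple_sum S : has_sum quadruple_term S ->
  S = \sum_(0 <= k < absz D)
    (- outer_coef k%:Z * usum (fun p : int * int => outer_term k%:Z p.1 p.2)).
Proof.
move=> HS.
have [N DN] : exists N : nat, D = N.+1%:Z.
  by exists (absz D).-1; rewrite /D expr2; nia.
rewrite DN big_mkord.
pose phi (p : 'I_N.+1 * ((int * int) * (int * int))) : (int * int) * (int * int) :=
  (p.2.2, (p.2.1.1, p.1%:Z + D * p.2.1.2)).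
pose psi (p : (int * int) * (int * int)) : 'I_N.+1 * ((int * int) * (int * int)) :=
  (inord (absz (p.2.2 %% D)%Z), ((p.2.1, (p.2.2 %/ D)%Z), p.1)).
have phiK : cancel phi psi.
  move=> [k [[M T] rs]]; rewrite /phi /psi /=; have kN := ltn_ord k.
  have -> : ((k%:Z + D * T) %% D)%Z = k.
    by rewrite addrC mulrC DN modzMDl modz_small //; lia.
  have -> : ((k%:Z + D * T) %/ D)%Z = T.
    by rewrite addrC mulrC DN divzMDl // divz_small ?addr0 //; lia.
  by rewrite /= inord_val.
have psiK : cancel psi phi.
  move=> [rs [M n]]; rewrite /phi /psi /= inordK; last by rewrite DN; lia.
  have D0 : D != 0 by rewrite DN.
  by rewrite gez0_abs ?modz_ge0 // addrC mulrC -divz_eq.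
have H := has_sum_bij phiK psiK HS.
have aS := abs_summable_inj (can_inj phiK) abs_summable_quadruple_term.
pose F (k : 'I_N.+1) := - outer_coef k%:Z * usum (fun p : int * int => outer_term k%:Z p.1 p.2).
suff HF : has_sum F S by exact: (has_sum_unique HF (@has_sum_fin _ _ F)).
apply: has_sum_fubini H _ => k; rewrite /F.
pose f (j : (int * int) * (int * int)) := quadruple_term (j.2, (j.1.1, k%:Z + D * j.1.2)).
have af : abs_summable f.
  by apply: (abs_summable_inj (h := fun j => (k, j)) _ aS) => ? ? [].
have [Sk Hk] := abs_summable_has_sum af.
have Hg : has_sum (fun p : int * int => - outer_coef k%:Z * outer_term k%:Z p.1 p.2) Sk.
  have kD : 0 <= k%:Z < D by have := ltn_ord k; rewrite DN; lia.
  by apply: (has_sum_fubini Hk) => p; exact: (@quadruple_inner_sum k p.1 p.2 kD).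
rewrite -(usum_of_has_sumZ Hg); exact: Hk.
Qed.

End Main.

Theorem theorem1p4 (R : realType) (q : R[i]) (hq0 : q != 0) (hq1 : `|q| < 1)
    (t m : int) (ht : 1 <= t) (hm : 1 - t <= m <= t)
    (x : R[i]) (hx0 : x != 0) (hx : forall n : int, x != q ^ (2 * n + 1)) :
  calO t m x q =
    q ^ (3 - 8 * t ^+ 2 - 2 * (m - 1) * (2 * t - 1))
    / (theta (x * q) (q ^+ 2) * qpoch_inf (q ^+ 2) (q ^+ 2) ^+ 2)
    * \sum_(0 <= k < absz (4 * t ^+ 2 - 1)%R)
        ((-1) ^+ k.+1 * q ^+ (k ^ 2 + 3 * k)%N
         * hecke_f 1 (2 * t) 1
             (q ^ (2 * t + 2 * m + 2 - 8 * t ^+ 2 + 2 * k%:Z))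
             (q ^ (2 * t + 2 * m))
             (q ^+ 2)
         * hecke_f 1 (4 * t ^+ 2 - 1) (4 * t ^+ 2 * (4 * t ^+ 2 - 1))
             (x^-1 * q ^ (2 * k%:Z + 1))
             (- q ^ (16 * t ^+ 4 - 4 * t ^+ 2 - 2 * (m - 1) * (2 * t - 1)
                     + 8 * t ^+ 2 * k%:Z))
             (q ^+ 2)).
Proof.
have xq0 : x * q != 0 by rewrite mulf_neq0.
(* An even power q^(2n) for x q would make x the odd power q^(2(n-1)+1). *)
have hy (n : int) : x * q != q ^ (2 * n).
  have := hx (n - 1); apply: contra_neq => h; apply: (mulIf hq0).
  rewrite h -[X in _ = _ * X]expr1z -(exprqD hq0); congr (q ^ _); ring.
have [S HS] := abs_summable_has_sum (abs_summable_quadruple_term hq0 hq1 ht hm xq0).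
rewrite /calO [q * x]mulrC (p_sum_eq hq0 hq1 ht hm xq0 hy HS).
rewrite (quadruple_sum hq0 hq1 ht hm xq0 HS).
have combine (T P A B S1 S2 : R[i]) :
    A * S1 = B * S2 -> A / P * (S1 / T) = B / (T * P) * S2.
  move=> E; transitivity (A * S1 * (T^-1 * P^-1)); first by ring.
  by rewrite E invfM; ring.
apply: combine; rewrite !mulr_sumr; apply: eq_bigr => k _.
rewrite (hecke_outer hq0 t m xq0 k (erefl (x * q))).
have -> : 2 * t + 2 * m + 2 - 8 * t ^+ 2 + 2 * k%:Z =
    2 * (t + m - (4 * t ^+ 2 - 1) + k%:Z) by ring.
have -> : 2 * t + 2 * m = 2 * (t + m) by ring.
rewrite (hecke_f_sum hq0 hq1 ht).
rewrite /outer_coef; move: (usum _) (hecke_sum _ _ _ _) => u h.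
have regroup (a A B A' B' : R[i]) : A * B = A' * B' ->
    A * (- (a * B * h) * u) = A' * (- a * B' * h * u).
  move=> E; transitivity (- (a * h * u * (A * B))); first by ring.
  by rewrite E; ring.
rewrite (exprS (-1)) mulN1r; apply: regroup.
(* What remains is 1 - 2 (2 t - 1)(2 t + m) = 3 - 8 t^2 - 2 (m - 1)(2 t - 1), the 1 coming from the
   factor q in [calO]. *)
rewrite -{1}(expr1z q) [q ^+ (_ + _)]exprnP -!(exprqD hq0); congr (q ^ _).
rewrite -[(k ^ 2)%N]mulnn PoszD !PoszM; ring.
Qed.
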